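(* Let $F$ be a field of characteristic $0$ and let $SAlt[a;x]$ be the free alternative superalgebra over $F$ on one even generator $a$ and one odd generator $x$. For homogeneous $b$ put $b_0=b$, $b_{i+1}=[b_i,x]_s$, and for $n\ge 2$ put $$u_n=u_n(a,x)=\bigl((a^2)_{n-1},a,x\bigr)-\bigl(a_{n-1},a^2,x\bigr)\in SAlt[a;x].$$ Then for every $m\ge 1$ the element $u_{4m+1}$ lies in the verbal subsuperalgebra generated by $u_{4m}$.
   Context: A superalgebra is a $\mathbb Z/2$-graded (nonassociative) $F$-algebra; it is an alternative superalgebra if its Grassmann envelope $(G_{\bar 0}\otimes A_{\bar 0})\oplus(G_{\bar 1}\otimes A_{\bar 1})$ is alternative ($G$ the Grassmann algebra on countably many generators). Associator $(p,q,r)=(pq)r-p(qr)$; supercommutator $[p,q]_s=pq-(-1)^{|p||q|}qp$ for homogeneous $p,q$. Verbal subsuperalgebra generated by $u_{4m}$: the element $u_{4m}(a,x)$ is, up to a nonzero scalar, the super-version of the element $u_{4m}(a;x_1,\ldots,x_{4m})=([a^2,x_1,\ldots,x_{4m-1}],a,x_{4m})-([a,x_1,\ldots,x_{4m-1}],a^2,x_{4m})$ of a free alternative algebra (ordinary left-normed commutators), which is skew-symmetric in $x_1,\ldots,x_{4m}$ and of degree $3$ in $a$. Let $f(z_1,\ldots,z_r)$, $r=4m+3$, be its complete linearization, i.e. the component of $u_{4m}(z_1+z_2+z_3;z_4,\ldots,z_r)$ of degree $1$ in each $z_i$. Writing $f=\sum \alpha_{\sigma,\beta}\,(z_{\sigma(1)}\cdots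 z_{\sigma(r)})_\beta$ ($\beta$ runs over bracketings), its super-version is the multilinear function on homogeneous elements $\tilde f(h_1,\ldots,h_r)=\sum \alpha_{\sigma,\beta}\,\varepsilon_\sigma\,(h_{\sigma(1)}\cdots h_{\sigma(r)})_\beta$, where $\varepsilon_\sigma$ is the sign of the permutation induced by $\sigma$ on the odd elements among $h_1,\ldots,h_r$. The verbal subsuperalgebra generated by $u_{4m}$ is the subsuperalgebra of $SAlt[a;x]$ generated by all values $\tilde f(h_1,\ldots,h_r)$ with $h_1,\ldots,h_r$ homogeneous elements of $SAlt[a;x]$. *)

(* Defs.v *)
From HB Require Import structures.
From mathcomp Require Import all_boot all_order all_algebra finmap.
From mathcomp.multinomials Require Import monalg.

Set Implicit Arguments.
Unset Strict Implicit.
Unset Printing Implicit Defensive.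

Import GRing.Theory.
Local Open Scope ring_scope.

(* The grading A = A_0 (+) A_1 is given by the two projections onto the
   homogeneous components ([false] is even, [true] is odd).  The product is
   bilinear; it is neither associative nor unital in general. *)
HB.mixin Record Lmodule_isSuperalgebra (F : fieldType) A of GRing.Lmodule F A := {
  smul : A -> A -> A;
  spart : bool -> A -> A;
  smul_linearl : forall v, linear (smul^~ v);
  smul_linearr : forall u, linear (smul u);
  spart_linear : forall i, linear (spart i);
  spart_sum : forall u, spart false u + spart true u = u;
  spart_proj : forall i j u, spart i (spart j u) = if i == j then spart j u else 0;
  smul_graded : forall i j u v,
    spart (i (+) j) (smul (spart i u) (spart j v)) = smul (spart i u) (spart j v)
}.

#[short(type="superalgType")]
HB.structure Definition Superalgebra (F : fieldType) :=
  {A of Lmodule_isSuperalgebra F A & GRing.Lmodule F A}.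

Definition homogeneous (F : fieldType) (A : superalgType F) (i : bool) (u : A) :=
  spart i u = u.

Section Nonassociative.
Variables (V : zmodType) (mul : V -> V -> V).

Definition associator (p q r : V) : V := mul (mul p q) r - mul p (mul q r).

Definition commutator (p q : V) : V := mul p q - mul q p.

(* u_n(a; x_1, ..., x_n), with x_i = [x i] for 1 <= i <= n *)
Definition u_ordinary (n : nat) (a : V) (x : nat -> V) : V :=
  let lnc b := foldl commutator b [seq x i | i <- iota 1 n.-1] in
  associator (lnc (mul a a)) a (x n) - associator (lnc a) (mul a a) (x n).

End Nonassociative.

Section Grassmann.
Variables (F : fieldType) (A : superalgType F).

(* The Grassmann algebra G has the basis e_S, S a finite subset of nat, with
   e_S e_T = gsign S T *: e_(S :|: T).  An element of G (x) A is a finitely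
   supported family of elements of A, << u *g S >> standing for e_S (x) u. *)
Definition gsign (S T : {fset nat}) : F :=
  if [disjoint S & T]%fset then
    (-1) ^+ (\sum_(i <- S) \sum_(j <- T) (j < i))%N
  else 0.

Definition gmul (u v : {malg A[{fset nat}]}) : {malg A[{fset nat}]} :=
  \sum_(S <- msupp u) \sum_(T <- msupp v)
    << gsign S T *: smul u@_S v@_T *g (S `|` T)%fset >>.

Definition grassmann_envelope (u : {malg A[{fset nat}]}) : Prop :=
  forall S : {fset nat}, homogeneous (odd #|` S|) u@_S.

Definition alternative_superalgebra : Prop :=
  forall u v, grassmann_envelope u -> grassmann_envelope v ->
    associator gmul u u v = 0 /\ associator gmul v u u = 0.

End Grassmann.

Definition superalg_morphism (F : fieldType) (A B : superalgType F) (phi : A -> B) :=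
  [/\ linear phi,
      {morph phi : u v / smul u v} &
      forall i, {morph phi : u / spart i u}].

(* A is SAlt[a; x]: the free alternative superalgebra on the even generator a
   and the odd generator x. *)
Definition free_alternative_superalgebra (F : fieldType) (A : superalgType F)
    (a x : A) : Prop :=
  [/\ alternative_superalgebra A,
      homogeneous false a,
      homogeneous true x &
      forall (B : superalgType F) (b y : B),
        alternative_superalgebra B -> homogeneous false b -> homogeneous true y ->
        exists! phi : A -> B,
          [/\ superalg_morphism phi, phi a = b & phi x = y]].

Section SuperU.
Variables (F : fieldType) (A : superalgType F).

(* the bilinear extension of pq - (-1)^(|p||q|) qp *)
Definition scommutator (p q : A) : A :=
  \sum_(i : bool) \sum_(j : bool)
    (smul (spart i p) (spart j q)
     - (-1) ^+ (i && j) *: smul (spart j q) (spart i p)).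

Definition scomm_iter (x b : A) (n : nat) : A :=
  iter n (fun c => scommutator c x) b.

Definition u_super (n : nat) (a x : A) : A :=
  associator smul (scomm_iter x (smul a a) n.-1) a x
  - associator smul (scomm_iter x a n.-1) (smul a a) x.

End SuperU.

Inductive word (T : Type) := Letter of T | Join of word T & word T.

Section WordChoice.
Variable T : choiceType.

Fixpoint tree_of_word (w : word T) : GenTree.tree T :=
  match w with
  | Letter t => GenTree.Leaf t
  | Join s t => GenTree.Node 0 [:: tree_of_word s; tree_of_word t]
  end.

Fixpoint word_of_tree (t : GenTree.tree T) : option (word T) :=
  match t with
  | GenTree.Leaf t => Some (Letter t)
  | GenTree.Node _ [:: t1; t2] =>
      if (word_of_tree t1, word_of_tree t2) is (Some s1, Some s2)
      then Some (Join s1 s2) else None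
  | _ => None
  end.

Lemma tree_of_wordK : pcancel tree_of_word word_of_tree.
Proof. by elim=> //= s -> t ->. Qed.

HB.instance Definition _ := Choice.copy (word T) (pcan_type tree_of_wordK).

End WordChoice.

Fixpoint letters (T : Type) (w : word T) : seq T :=
  match w with
  | Letter t => [:: t]
  | Join s t => letters s ++ letters t
  end.

Section SuperVersion.
Variable F : fieldType.

(* {malg F[word T]} with this product is the free nonassociative algebra on T. *)
Definition nmul (T : choiceType) (p q : {malg F[word T]}) : {malg F[word T]} :=
  \sum_(s <- msupp p) \sum_(t <- msupp q) << p@_s * q@_t *g Join s t >>.

Definition zvar (i : nat) : {malg F[word nat]} := << Letter i >>.

Definition multilinear_part (r : nat) (p : {malg F[word nat]}) : {malg F[word nat]} :=
  \sum_(w <- msupp p | perm_eq (letters w) (iota 1 r)) << p@_w *g w >>.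

(* f(z_1, ..., z_(n + 3)), the complete linearization of u_n *)
Definition u_linearized (n : nat) : {malg F[word nat]} :=
  multilinear_part (n + 3)
    (u_ordinary (@nmul nat) n (zvar 1 + zvar 2 + zvar 3) (fun i => zvar (i + 3))).

Fixpoint inversions (s : seq nat) : nat :=
  if s is i :: s' then (count (fun j => j < i)%N s' + inversions s')%N else 0%N.

Variable A : superalgType F.

Fixpoint word_eval (T : Type) (h : T -> A) (w : word T) : A :=
  match w with
  | Letter t => h t
  | Join s t => smul (word_eval h s) (word_eval h t)
  end.

(* Value of the super-version of f at z_i := h i, where h i has parity e i: the
   sign is that of the permutation induced by the letters of w on the odd h i.  Only the e i and
   h i for the letters z_i occurring in f matter. *)
Definition super_version (f : {malg F[word nat]}) (e : nat -> bool) (h : nat -> A) : A :=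
  \sum_(w <- msupp f)
    (f@_w * (-1) ^+ inversions [seq i <- letters w | e i]) *: word_eval h w.

Definition subsuperalgebra (S : A -> Prop) : Prop :=
  [/\ S 0,
      forall (c : F) u v, S u -> S v -> S (c *: u + v),
      forall u v, S u -> S v -> S (smul u v) &
      forall i u, S u -> S (spart i u)].

Definition generated_subsuperalgebra (X : A -> Prop) (u : A) : Prop :=
  forall S, subsuperalgebra S -> (forall v, X v -> S v) -> S u.

Definition u_value (n : nat) (v : A) : Prop :=
  exists (e : nat -> bool) (h : nat -> A),
    (forall i, homogeneous (e i) (h i)) /\
    v = super_version (u_linearized n) e h.

Definition verbal_subsuperalgebra (n : nat) : A -> Prop :=
  generated_subsuperalgebra (u_value n).

End SuperVersion.

Arguments verbal_subsuperalgebra {F} A n.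

(* Main.v *)
Require Import Defs.
From Stdlib Require ZArith QArith Qreduction.
From HB Require Import structures.
From mathcomp Require Import all_boot all_order all_algebra finmap.
From mathcomp Require Import ssrZ zify.
From mathcomp.multinomials Require Import monalg.

Set Implicit Arguments.
Unset Strict Implicit.
Unset Printing Implicit Defensive.

Import GRing.Theory.
Local Open Scope ring_scope.

(** Let D u = [u, x] be the supercommutator with x, and write p = aa, p_i = D^i p,
    a_i = D^i a, T(u, v) = (u, v, x), n = 4m.

    The proof evaluates the super-version of the linearized u_n at z_1 = z_2 = a, z_3 = [a, x]
    and z_i = x for i > 3. An ordinary commutator with a letter larger than the preceding
    ones becomes a supercommutator, so that the value is
      2 (T(p_n, a) - T(a_n, p) - T(p_(n-1), a_1) + T(a_(n-1), p_1))
    ([super_version_special]). The first two terms make up u_(n+1). As T(p, a_n) = - T(a_n, p)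
    and T(p_1, a_(n-1)) = T(a_(n-1), p_1), so do the last two terms, provided that
      T(p_n, a) + T(p, a_n) + T(p_(n-1), a_1) - T(p_1, a_(n-1)) = 0,
    which is [boundary_relation]. The value is then 4 u_(n+1).

    The boundary relation holds in every alternative superalgebra, for every even a. It
    results from two facts.

    First, T(bb, b) = 0 for every even b, and this property of a biadditive form Phi is
    inherited by Phi(D^2 u, v) + Phi(u, D^2 v), because the linearization
    Phi(bc + cb, b) + Phi(bb, c) = 0 can be applied to c = D^2 b, where
    D^2(bb) = b D^2 b + (D^2 b) b. Hence the sum of the T(p_(2i), a_(n-2i)), with binomial
    coefficients, is zero ([cyclic_shift]).

    Second, for even p and q put F_ij = (-1)^j T(p_(i+1), q_j) + T(p_i, q_(j+1)). Then
    F_ij = 0 for i, j > 0 and i + j odd, i + j >= 7 ([tdefect_interior]). Indeed the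
    supercommutators of an alternative superalgebra satisfy Sagle's identity, and their
    Jacobian is six times the associator ([super_sagle], [super_jacobi]); it follows that
      2 F_23 + 5 F_14 = 2 F_32 + 5 F_14 = F_41 - F_14 = 0
    ([malcev_identities]), and for i + j = 7 these relations, written for (D^2 p, q) and
    (p, D^2 q), form a nonsingular linear system. If n >= 8, this makes the inner terms of the
    binomial sum alternate in sign, and the sum collapses to the boundary relation
    ([alternating_array]). If n = 4, one more consequence of Sagle's identity is used.

    The identities of low degree are consequences of instances of known ones. They are checked
    by a verified Gaussian elimination with rational coefficients on linear combinations of
    words, evaluated by the kernel ([sound_relate], [veval_red]). *)

(** * Additive maps and sums over the support *)

Section Additive.
Variables (V W : zmodType) (f : V -> W).
Hypothesis fD : {morph f : u v / u + v}.

Lemma additive0 : f 0 = 0.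
Proof. by apply: (addrI (f 0)); rewrite -fD !addr0. Qed.

Lemma additiveN u : f (- u) = - f u.
Proof. by apply: (addrI (f u)); rewrite -fD !subrr additive0. Qed.

Lemma additiveB u v : f (u - v) = f u - f v.
Proof. by rewrite fD additiveN. Qed.

Lemma additive_sum I (r : seq I) (P : pred I) (F : I -> V) :
  f (\sum_(i <- r | P i) F i) = \sum_(i <- r | P i) f (F i).
Proof. exact: (big_morph f fD additive0). Qed.

End Additive.

Section Biadditive.
Variables (V : zmodType) (mul : V -> V -> V).
Hypothesis mulDl : forall v, {morph mul^~ v : u u' / u + u'}.
Hypothesis mulDr : forall u, {morph mul u : v v' / v + v'}.

Lemma commutator_addl v : {morph (commutator mul)^~ v : u u' / u + u'}.
Proof. by move=> u u'; rewrite /commutator mulDl mulDr opprD addrACA. Qed.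

Lemma associator_addl v w : {morph (fun u => associator mul u v w) : u u' / u + u'}.
Proof. by move=> u u'; rewrite /associator !mulDl opprD addrACA. Qed.

Lemma associator_addm u w : {morph (fun v => associator mul u v w) : v v' / v + v'}.
Proof. by move=> v v'; rewrite /associator mulDr !mulDl mulDr opprD addrACA. Qed.

Lemma associator_addr u v : {morph associator mul u v : w w' / w + w'}.
Proof. by move=> w w'; rewrite /associator !mulDr opprD addrACA. Qed.

End Biadditive.

Section SuppSum.
Variables (K : choiceType) (G V : zmodType) (h : K -> G -> V).
Hypothesis hD : forall k, {morph h k : x y / x + y}.

(** The additive extension of h to the finitely supported families. *)
Definition suppsum (u : {malg G[K]}) : V := \sum_(k <- msupp u) h k u@_k.

Let h0 k : h k 0 = 0 := additive0 (hD k).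

Lemma suppsumE (D : {fset K}) (u : {malg G[K]}) :
  {subset msupp u <= D} -> suppsum u = \sum_(k <- D) h k u@_k.
Proof.
move=> sub; rewrite /suppsum.
rewrite [RHS](big_fsetID _ (mem (msupp u))) /=.
rewrite [X in _ = _ + X]big1_fset ?addr0 => [|k]; last first.
  by rewrite !inE => /andP[_ ku] _; rewrite mcoeff_outdom // h0.
apply: eq_fbigl => k; rewrite !inE /=.
by case ku: (k \in msupp u); rewrite ?andbT ?andbF // (sub _ ku).
Qed.

Lemma suppsumD : {morph suppsum : u v / u + v}.
Proof.
move=> u v; pose D := (msupp u `|` msupp v)%fset.
rewrite (@suppsumE D) ?(@suppsumE D u) ?(@suppsumE D v).
- by rewrite -big_split /=; apply: eq_bigr => k _; rewrite mcoeffD hD.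
- by move=> k ku; rewrite inE ku orbT.
- by move=> k ku; rewrite inE ku.
- by move=> k; apply/fsubsetP/msuppD_le.
Qed.

Lemma suppsumU k c : suppsum << c *g k >> = h k c.
Proof.
rewrite (@suppsumE [fset k]%fset) ?big_seq_fset1 ?mcoeffUU //.
by apply/fsubsetP/msuppU_le.
Qed.

End SuppSum.

(** * Alternative superalgebras *)

Section SuperalgTheory.
Variables (F : fieldType) (A : superalgType F).
Implicit Types (u v w : A) (i j k : bool).

Lemma smulDl v : {morph (@smul F A)^~ v : u w / u + w}.
Proof. by move=> u w; have := smul_linearl v 1 u w; rewrite !scale1r. Qed.
Lemma smulDr u : {morph smul u : v w / v + w}.
Proof. by move=> v w; have := smul_linearr u 1 v w; rewrite !scale1r. Qed.
Lemma smul0l v : smul 0 v = 0.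
Proof. exact: additive0 (smulDl v). Qed.
Lemma smul0r u : smul u 0 = 0.
Proof. exact: additive0 (smulDr u). Qed.
Lemma smulNl u v : smul (- u) v = - smul u v.
Proof. exact: additiveN (smulDl v) u. Qed.
Lemma smulNr u v : smul u (- v) = - smul u v.
Proof. exact: additiveN (smulDr u) v. Qed.
Lemma smulBl u w v : smul (u - w) v = smul u v - smul w v.
Proof. by rewrite smulDl smulNl. Qed.
Lemma smulBr u v w : smul u (v - w) = smul u v - smul u w.
Proof. by rewrite smulDr smulNr. Qed.
Lemma smulZl c u v : smul (c *: u) v = c *: smul u v.
Proof. by have := smul_linearl v c u 0; rewrite /= !addr0 smul0l addr0. Qed.
Lemma smulZr c u v : smul u (c *: v) = c *: smul u v.
Proof. by have := smul_linearr u c v 0; rewrite /= !addr0 smul0r addr0. Qed.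

Lemma spartD i : {morph @spart F A i : u v / u + v}.
Proof. by move=> u v; have := spart_linear i 1 u v; rewrite !scale1r. Qed.
Lemma spart0 i : spart i (0 : A) = 0.
Proof. exact: additive0 (spartD i). Qed.
Lemma spartZ i c u : spart i (c *: u) = c *: spart i u.
Proof. by have := spart_linear i c u 0; rewrite !addr0 spart0 addr0. Qed.
Lemma spartN i u : spart i (- u) = - spart i u.
Proof. by rewrite -scaleN1r spartZ scaleN1r. Qed.

Lemma homogeneous0 i : homogeneous i (0 : A). Proof. exact: spart0. Qed.
Lemma homogeneousD i u v :
  homogeneous i u -> homogeneous i v -> homogeneous i (u + v).
Proof. by rewrite /homogeneous spartD => -> ->. Qed.
Lemma homogeneousZ i c u : homogeneous i u -> homogeneous i (c *: u).
Proof. by rewrite /homogeneous spartZ => ->. Qed.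
Lemma homogeneousN i u : homogeneous i u -> homogeneous i (- u).
Proof. by rewrite /homogeneous spartN => ->. Qed.
Lemma homogeneousB i u v :
  homogeneous i u -> homogeneous i v -> homogeneous i (u - v).
Proof. by move=> hu hv; apply/homogeneousD/homogeneousN. Qed.
Lemma homogeneousM i j u v :
  homogeneous i u -> homogeneous j v -> homogeneous (i (+) j) (smul u v).
Proof. by rewrite /homogeneous => hu hv; have := smul_graded i j u v; rewrite hu hv. Qed.
Lemma spart_homogeneous i j u : homogeneous j u -> spart i u = if i == j then u else 0.
Proof.
move=> hu; rewrite -{1}[u](hu : spart j u = u) spart_proj.
by rewrite (hu : spart j u = u).
Qed.

(** The sign of a transposition of two elements of parities i and j. *)
Definition ksign i j : F := (-1) ^+ (i && j).

Lemma scommutatorE i j u v : homogeneous i u -> homogeneous j v ->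
  scommutator u v = smul u v - ksign i j *: smul v u.
Proof.
move=> hu hv; rewrite /scommutator /ksign !big_bool /=.
rewrite !(spart_homogeneous _ hu) !(spart_homogeneous _ hv).
by case: i {hu}; case: j {hv};
   rewrite /= !(smul0l, smul0r, scaler0, oppr0, addr0, add0r).
Qed.

Lemma homogeneous_scommutator i j u v : homogeneous i u -> homogeneous j v ->
  homogeneous (i (+) j) (scommutator u v).
Proof.
move=> hu hv; rewrite (scommutatorE hu hv).
apply: homogeneousB; first exact: homogeneousM.
by apply: homogeneousZ; rewrite addbC; apply: homogeneousM.
Qed.

Local Notation assoc := (associator (@smul F A)).

Lemma associatorDl v w : {morph (fun u => assoc u v w) : u u' / u + u'}.
Proof. exact: associator_addl smulDl _ _. Qed.
Lemma associatorDm u w : {morph (fun v => assoc u v w) : v v' / v + v'}.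
Proof. exact: associator_addm smulDl smulDr _ _. Qed.
Lemma associatorDr u v : {morph (fun w => assoc u v w) : w w' / w + w'}.
Proof. exact: associator_addr smulDr _ _. Qed.

Lemma ksignC i j : ksign i j = ksign j i.
Proof. by rewrite /ksign andbC. Qed.
Lemma ksignK i j : ksign i j * ksign i j = 1.
Proof. by rewrite /ksign -signr_addb addbb. Qed.

(** ** Skew-symmetry of the associator, from the Grassmann envelope *)

Notation malgA := {malg A[{fset nat}]}.

Lemma gmulE (x y : malgA) : gmul x y =
  suppsum (fun S p => suppsum (fun T q =>
    << gsign F S T *: smul p q *g (S `|` T)%fset >>) y) x.
Proof. by []. Qed.

Let inner_addr (S : {fset nat}) p (T : {fset nat}) :
  {morph (fun q : A => << gsign F S T *: smul p q *g (S `|` T)%fset >>) :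
    q q' / q + q'}.
Proof. by move=> q q'; rewrite smulDr scalerDr monalgUD. Qed.

Let outer_addr y (S : {fset nat}) :
  {morph (fun p : A => suppsum (fun T q =>
    << gsign F S T *: smul p q *g (S `|` T)%fset >>) y) : p p' / p + p'}.
Proof.
move=> p p'; rewrite /suppsum -big_split /=; apply: eq_bigr => T _.
by rewrite smulDl scalerDr monalgUD.
Qed.

Lemma gmulDl (y : malgA) : {morph (@gmul F A)^~ y : x x' / x + x'}.
Proof. by move=> x x'; rewrite !gmulE suppsumD //; exact: (outer_addr y). Qed.

Lemma gmulDr (x : malgA) : {morph gmul x : y y' / y + y'}.
Proof.
move=> y y'; rewrite !gmulE /suppsum -big_split /=; apply: eq_bigr => S _.
exact: (suppsumD (inner_addr S x@_S)  y y').
Qed.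

Lemma gmulU (S T : {fset nat}) p q :
  gmul << p *g S >> << q *g T >>
    = << gsign F S T *: smul p q *g (S `|` T)%fset >> :> malgA.
Proof.
rewrite gmulE suppsumU; last exact: (outer_addr << q *g T >>).
by rewrite suppsumU // => T'; exact: (inner_addr S p T').
Qed.

Lemma gsign_lt (S T : {fset nat}) :
  (forall s t, s \in S -> t \in T -> (s < t)%N) -> gsign F S T = 1.
Proof.
move=> ST; rewrite /gsign ifT.
  by rewrite big1_fset // => s sS _; rewrite big1_fset // => t tT _; rewrite ltnNge ltnW // ST.
apply/fdisjointP => s sS; apply/negP => /(ST _ _ sS); by rewrite ltnn.
Qed.

Lemma gsign_gt (S T : {fset nat}) :
  (forall s t, s \in S -> t \in T -> (t < s)%N) ->
  gsign F S T = (-1) ^+ (#|` S| * #|` T|).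
Proof.
move=> ST; rewrite /gsign ifT.
congr (_ ^+ _).
  have cT s : s \in S -> (\sum_(j <- T) (j < s) = #|` T|)%N.
    move=> sS; rewrite [LHS]big_seq (eq_bigr (fun _ => 1%N)); last by move=> t /ST ->.
    by rewrite -big_seq sum1_size.
  rewrite big_seq (eq_bigr _ cT) -big_seq big_const_seq count_predT.
  by rewrite iter_addn_0 mulnC.
apply/fdisjointP => s sS; apply/negP => /(ST _ _ sS); by rewrite ltnn.
Qed.

Lemma envelopeU i (S : {fset nat}) p : homogeneous i p -> odd #|` S| = i ->
  grassmann_envelope (<< p *g S >> : malgA).
Proof.
move=> hp Si T; rewrite mcoeffU; have [<-|_] := eqVneq S T.
  by rewrite Si mulr1n.
by rewrite mulr0n; apply: homogeneous0.
Qed.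

Lemma envelopeD (x y : malgA) :
  grassmann_envelope x -> grassmann_envelope y -> grassmann_envelope (x + y).
Proof. by move=> hx hy S; rewrite mcoeffD; apply: homogeneousD. Qed.

Local Notation gassoc := (associator (@gmul F A)).

Hypothesis altA : alternative_superalgebra A.

(** The index set of a basis element of the Grassmann algebra that has parity i: the
    generator number n if i is odd, and 1 if i is even. *)
Definition blade (n : nat) i : {fset nat} := if i then [fset n]%fset else fset0.

Lemma card_blade n i : #|` blade n i| = i.
Proof. by case: i; rewrite /= ?cardfs1 ?cardfs0. Qed.

Lemma in_blade n i m : m \in blade n i -> m = n.
Proof. by case: i; rewrite !inE // => /eqP. Qed.

Lemma big_fsetU_disjoint (T U : {fset nat}) (f : nat -> nat) :
  [disjoint T & U]%fset ->
  (\sum_(j <- (T `|` U)%fset) f j = \sum_(j <- T) f j + \sum_(j <- U) f j)%N.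
Proof.
move=> /fdisjointP TU; rewrite -big_cat /=; apply: perm_big; apply: uniq_perm => //=.
- exact: fset_uniq.
- rewrite cat_uniq !fset_uniq andbT /=; apply/hasPn => t tU.
  by apply/negP => /TU; rewrite tU.
- by move=> t; rewrite mem_cat inE.
Qed.

Lemma gsignUr (S T U : {fset nat}) : [disjoint T & U]%fset ->
  gsign F S (T `|` U)%fset = gsign F S T * gsign F S U.
Proof.
move=> TU; rewrite /gsign fdisjointXU; case: ifP => [/andP[-> ->]|].
  by rewrite -exprD; congr (_ ^+ _); rewrite -big_split; apply: eq_bigr => s _;
     rewrite big_fsetU_disjoint.
by case: ifP => // _; case: ifP => // _ _; rewrite ?mulr0 ?mul0r.
Qed.

Lemma gsignUl (S T U : {fset nat}) : [disjoint S & T]%fset ->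
  gsign F (S `|` T)%fset U = gsign F S U * gsign F T U.
Proof.
move=> ST; rewrite /gsign fdisjointUX; case: ifP => [/andP[-> ->]|].
  by rewrite -exprD big_fsetU_disjoint.
by case: ifP => // _; case: ifP => // _ _; rewrite ?mulr0 ?mul0r.
Qed.

Lemma gassocU (S T U : {fset nat}) u v w :
  [disjoint S & T]%fset -> [disjoint T & U]%fset ->
  gassoc << u *g S >> << v *g T >> << w *g U >> =
  << (gsign F S T * gsign F S U * gsign F T U) *: assoc u v w *g (S `|` T `|` U)%fset >>.
Proof.
move=> ST TU; rewrite /associator !gmulU gsignUl // gsignUr // !(smulZl, smulZr) !scalerA.
rewrite fsetUA -monalgUB; congr << _ *g _ >>.
by rewrite scalerBr; congr (_ *: _ - _); rewrite mulrC mulrA.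
Qed.

Lemma blade_disjoint m n i j : m != n -> [disjoint blade m i & blade n j]%fset.
Proof.
move=> mn; apply/fdisjointP => s /in_blade ->; apply/negP => /in_blade mn'.
by rewrite mn' eqxx in mn.
Qed.

Lemma gsign_blade m n i j :
  m != n -> gsign F (blade m i) (blade n j) = if (m < n)%N then 1 else ksign i j.
Proof.
move=> mn; case: ltnP => [lt_mn|le_nm].
  by apply: gsign_lt => s t /in_blade -> /in_blade ->.
rewrite gsign_gt ?card_blade ?mulnb // => s t /in_blade -> /in_blade ->.
by rewrite ltn_neqAle eq_sym mn.
Qed.

Let polar_opp (p a b s : malgA) : p = 0 -> s = 0 -> p + a + (b + s) = 0 -> b = - a.
Proof.
by move=> -> -> E; apply/eqP; rewrite -addr_eq0 addrC -E add0r addr0.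
Qed.

Lemma gassocC_l (x y z : malgA) : grassmann_envelope x -> grassmann_envelope y ->
  grassmann_envelope z -> gassoc y x z = - gassoc x y z.
Proof.
move=> ex ey ez; have [xyz _] := altA (envelopeD ex ey) ez.
have [xxz _] := altA ex ez; have [yyz _] := altA ey ez.
apply: (polar_opp xxz yyz); rewrite -[RHS]xyz.
rewrite (associator_addl gmulDl _ z x y).
by rewrite (associator_addm gmulDl gmulDr x z x y) (associator_addm gmulDl gmulDr y z x y).
Qed.

Lemma gassocC_r (x y z : malgA) : grassmann_envelope x -> grassmann_envelope y ->
  grassmann_envelope z -> gassoc x z y = - gassoc x y z.
Proof.
move=> ex ey ez; have [_ xyz] := altA (envelopeD ey ez) ex.
have [_ xyy] := altA ey ex; have [_ xzz] := altA ez ex.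
apply: (polar_opp xyy xzz); rewrite -[RHS]xyz.
rewrite (associator_addm gmulDl gmulDr x _ y z).
by rewrite (associator_addr gmulDr x y y z) (associator_addr gmulDr x z y z).
Qed.

Lemma envelope_blade n i u : homogeneous i u ->
  grassmann_envelope (<< u *g blade n i >> : malgA).
Proof. by move=> hu; apply: (envelopeU hu); rewrite card_blade oddb. Qed.

Let monalgU_inj (S : {fset nat}) (p q : A) :
  << p *g S >> = << q *g S >> :> malgA -> p = q.
Proof.
move=> pq; rewrite -[p](mcoeffUU S p) -[RHS](mcoeffUU S q).
exact: (congr1 (mcoeff S) pq).
Qed.

Lemma gassoc_blades m n o i j k u v w : m != n -> n != o -> m != o ->
  gassoc << u *g blade m i >> << v *g blade n j >> << w *g blade o k >> =
  << ((if (m < n)%N then 1 else ksign i j) * (if (m < o)%N then 1 else ksign i k)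
      * (if (n < o)%N then 1 else ksign j k)) *: assoc u v w
     *g (blade m i `|` blade n j `|` blade o k)%fset >>.
Proof.
move=> mn no mo.
rewrite (gassocU u v w (blade_disjoint i j mn) (blade_disjoint j k no)).
rewrite (gsign_blade i j mn) (gsign_blade i k mo) (gsign_blade j k no).
exact: erefl.
Qed.

(** The associator of an alternative superalgebra is skew-symmetric up to the sign rule:
    give to the three arguments disjoint blades and compare the coefficients in the
    linearized alternative law of the Grassmann envelope. *)
Lemma associatorC_l i j k u v w :
  homogeneous i u -> homogeneous j v -> homogeneous k w ->
  assoc v u w = - (ksign i j *: assoc u v w).
Proof.
move=> hu hv hw.
have := gassocC_l (envelope_blade 0 hu) (envelope_blade 1 hv) (envelope_blade 2 hw).
rewrite (@gassoc_blades 1 0 2) // (@gassoc_blades 0 1 2) //= !mulr1 scale1r.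
rewrite [(blade 1 j `|` _)%fset]fsetUC -monalgUN.
move=> /monalgU_inj yxz.
by rewrite -[LHS]scale1r -(ksignK j i) -scalerA yxz scalerN ksignC.
Qed.

Lemma associatorC_r i j k u v w :
  homogeneous i u -> homogeneous j v -> homogeneous k w ->
  assoc u w v = - (ksign j k *: assoc u v w).
Proof.
move=> hu hv hw.
have := gassocC_r (envelope_blade 0 hu) (envelope_blade 1 hv) (envelope_blade 2 hw).
rewrite (@gassoc_blades 0 2 1) // (@gassoc_blades 0 1 2) //= !mul1r scale1r -!fsetUA.
rewrite [(blade 2 k `|` _)%fset]fsetUC -monalgUN.
move=> /monalgU_inj xzy.
by rewrite -[LHS]scale1r -(ksignK k j) -scalerA xzy scalerN ksignC.
Qed.

End SuperalgTheory.

(** * Linear elimination over the rationals *)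

(* Rational numbers in lowest terms, with operations that the kernel can evaluate. *)
Notation Q := QArith_base.Q.
Definition qadd (a b : Q) : Q := Qreduction.Qred (QArith_base.Qplus a b).
Definition qmul (a b : Q) : Q := Qreduction.Qred (QArith_base.Qmult a b).
Definition qopp (a : Q) : Q := QArith_base.Qopp a.
Definition qinv (a : Q) : Q := QArith_base.Qinv a.
Definition qnull (a : Q) : bool :=
  if QArith_base.Qnum a is BinNums.Z0 then true else false.

(** The total order on words that selects the leading term of a relation. *)
Fixpoint wcmp (s t : word nat) : comparison :=
  match s, t with
  | Letter i, Letter j => PeanoNat.Nat.compare i j
  | Letter _, Join _ _ => Lt
  | Join _ _, Letter _ => Gt
  | Join a b, Join c d => match wcmp b d with Eq => wcmp a c | r => r end
  end.

Lemma wcmp_eq s t : wcmp s t = Eq -> s = t.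
Proof.
elim: s t => [i|a IHa b IHb] [j|c d] //= => [/PeanoNat.Nat.compare_eq ->//|].
by case E: (wcmp b d) => // /IHa ->; rewrite (IHb _ E).
Qed.

(** Linear combinations of words. [vadd] merges lists in decreasing order of the words, but
    the lemmas on the values hold for all lists, ordered or not. *)
Definition vec := seq (word nat * Q).

Fixpoint vadd (u : vec) : vec -> vec :=
  match u with
  | [::] => fun v => v
  | (k, a) :: u' =>
      fix aux (v : vec) : vec :=
        match v with
        | [::] => u
        | (l, b) :: v' =>
            match wcmp k l with
            | Gt => (k, a) :: vadd u' v
            | Lt => (l, b) :: aux v'
            | Eq => let c := qadd a b in
                    if qnull c then vadd u' v' else (k, c) :: vadd u' v'
            end
        end
  end.

Arguments vadd : simpl never.

Definition vscale (c : Q) (v : vec) : vec := [seq (k.1, qmul c k.2) | k <- v].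

Arguments vscale : simpl never.

(** A system of rewriting rules (leading word, its value), in a binary search tree. *)
Inductive rules := RLeaf | RNode of rules & word nat & vec & rules.

Fixpoint rfind (k : word nat) (m : rules) : option vec :=
  if m is RNode l k' v r then
    match wcmp k k' with Eq => Some v | Lt => rfind k l | Gt => rfind k r end
  else None.

Fixpoint radd (k : word nat) (v : vec) (m : rules) : rules :=
  if m is RNode l k' v' r then
    match wcmp k k' with
    | Eq => m
    | Lt => RNode (radd k v l) k' v' r
    | Gt => RNode l k' v' (radd k v r)
    end
  else RNode RLeaf k v RLeaf.

(** The reduction of v by the rules m, in at most n steps. *)
Fixpoint vred (n : nat) (m : rules) (v : vec) : vec :=
  match n, v with
  | n'.+1, (k, c) :: v' =>
      if rfind k m is Some r then vred n' m (vadd (vscale c r) v')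
      else (k, c) :: vred n' m v'
  | _, _ => v
  end.

(* any bound that exceeds the length of the reductions at hand *)
Definition fuel : nat := 40 * 25.

(** The rules m, to which the rule equivalent to v = 0 modulo m is added: one step of
    Gaussian elimination. *)
Definition relate (v : vec) (m : rules) : rules :=
  if vred fuel m v is (k, c) :: v' then
    if qnull c then m else radd k (vscale (qopp (qinv c)) v') m
  else m.

Section Elimination.
Variables (F : fieldType) (charF0 : [pchar F] =i pred0).

(** The image in F of an integer, and of a rational number. *)
Definition zval (z : BinNums.Z) : F := (int_of_Z z)%:~R.
Definition qval (q : Q) : F :=
  zval (QArith_base.Qnum q) / zval (BinNums.Zpos (QArith_base.Qden q)).

Lemma zvalD : {morph zval : x y / BinInt.Z.add x y >-> x + y}.
Proof. by move=> x y; rewrite /zval -intrD -rmorphD. Qed.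
Lemma zvalM : {morph zval : x y / BinInt.Z.mul x y >-> x * y}.
Proof. by move=> x y; rewrite /zval -intrM -rmorphM. Qed.
Lemma zvalN : {morph zval : x / BinInt.Z.opp x >-> - x}.
Proof. by move=> x; rewrite /zval -rmorphN -rmorphN. Qed.

Lemma zval0 : zval BinNums.Z0 = 0.
Proof. by rewrite /zval /= mulr0z. Qed.
Lemma zval_neg p : zval (BinNums.Zneg p) = - zval (BinNums.Zpos p).
Proof. exact: (zvalN (BinNums.Zpos p)). Qed.

Lemma zval_pos p : zval (BinNums.Zpos p) != 0.
Proof.
have [n pn] := Pnat.Pos2Nat.is_succ p.
by rewrite /zval /= pn (iffLR (pcharf0P F) charF0).
Qed.

Lemma zposM p q : BinNums.Zpos (BinPos.Pos.mul p q) =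
  BinInt.Z.mul (BinNums.Zpos p) (BinNums.Zpos q).
Proof. by []. Qed.

Lemma qval_eq a b : QArith_base.Qeq a b -> qval a = qval b.
Proof.
rewrite /QArith_base.Qeq => /(congr1 zval); rewrite !zvalM => ab.
by apply/eqP; rewrite /qval eqr_div ?zval_pos // ab mulrC.
Qed.

Lemma qvalD a b : qval (qadd a b) = qval a + qval b.
Proof.
rewrite /qadd (qval_eq (Qreduction.Qred_correct _)) /qval /QArith_base.Qplus /=.
by rewrite zposM zvalD !zvalM addf_div ?zval_pos.
Qed.

Lemma qvalM a b : qval (qmul a b) = qval a * qval b.
Proof.
rewrite /qmul (qval_eq (Qreduction.Qred_correct _)) /qval /QArith_base.Qmult /=.
by rewrite zposM !zvalM mulf_div.
Qed.

Lemma qvalN a : qval (qopp a) = - qval a.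
Proof. by rewrite /qval /= zvalN mulNr. Qed.

Lemma qvalV a : qval (qinv a) = (qval a)^-1.
Proof.
case: a => [[|p|p] d]; rewrite /qval /qinv /QArith_base.Qinv /=.
- by rewrite zval0 !mul0r invr0.
- by rewrite invf_div.
- by rewrite !zval_neg !mulNr invrN invf_div.
Qed.

Lemma qval_null a : qnull a -> qval a = 0.
Proof.
by case: a => [[|p|p] d] //= _; rewrite /qval zval0 mul0r.
Qed.

Lemma qval_neq0 a : ~~ qnull a -> qval a != 0.
Proof.
case: a => [[|p|p] d] //= _; rewrite /qval mulf_neq0 ?invr_eq0 ?zval_pos //=.
by rewrite zval_neg oppr_eq0 zval_pos.
Qed.

Variables (V : lmodType F) (val : word nat -> V).

(** The value of a linear combination when the word w is given the value val w. *)
Definition veval (v : vec) : V := \sum_(k <- v) qval k.2 *: val k.1.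

Lemma veval_nil : veval [::] = 0.
Proof. by rewrite /veval big_nil. Qed.
Lemma veval_cons k c v : veval ((k, c) :: v) = qval c *: val k + veval v.
Proof. by rewrite /veval big_cons. Qed.

Lemma vevalD u v : veval (vadd u v) = veval u + veval v.
Proof.
elim: u v => [|[k a] u IHu] v; first by rewrite veval_nil add0r.
elim: v => [|[l b] v IHv]; first by rewrite veval_nil addr0.
rewrite /vadd -/vadd.
case E: (wcmp k l); rewrite ?veval_cons.
- have <- := wcmp_eq E.
  have -> : qval a *: val k + veval u + (qval b *: val k + veval v)
            = qval (qadd a b) *: val k + veval (vadd u v).
    by rewrite addrACA -scalerDl qvalD IHu.
  case: ifP => [/qval_null ->|_]; first by rewrite scale0r add0r.
  by rewrite veval_cons.
- by rewrite IHv veval_cons addrCA.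
- by rewrite IHu veval_cons addrA.
Qed.

Lemma vevalZ c v : veval (vscale c v) = qval c *: veval v.
Proof.
rewrite /veval big_map scaler_sumr; apply: eq_bigr => k _ /=.
by rewrite qvalM scalerA.
Qed.

(** All the rules of m hold for the values val. *)
Fixpoint sound (m : rules) : Prop :=
  if m is RNode l k v r then [/\ sound l, val k = veval v & sound r] else True.

Lemma sound_find k m v : sound m -> rfind k m = Some v -> val k = veval v.
Proof.
elim: m => [//|l IHl k' v' r IHr] /= [sl kv' sr].
case E: (wcmp k k'); [|exact: IHl|exact: IHr].
by case=> <-; rewrite (wcmp_eq E).
Qed.

Lemma sound_add k v m : sound m -> val k = veval v -> sound (radd k v m).
Proof.
move=> + kv; elim: m => [//|l IHl k' v' r IHr] /= [sl kv' sr].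
by case: wcmp => //=; split => //; [apply: IHl|apply: IHr].
Qed.

Lemma veval_red n m v : sound m -> veval (vred n m v) = veval v.
Proof.
move=> sm; elim: n v => [//|n IHn] [//|[k c] v] /=.
case E: (rfind k m) => [r|]; rewrite ?veval_cons IHn //.
by rewrite vevalD vevalZ -(sound_find sm E).
Qed.

Lemma sound_relate v m : sound m -> veval v = 0 -> sound (relate v m).
Proof.
move=> sm; rewrite /relate -(veval_red fuel _ sm).
case: (vred _ _ _) => [//|[k c] {}v]; rewrite veval_cons => /eqP kv.
case: ifPn => // c0; apply: sound_add => //.
rewrite vevalZ qvalN qvalV scaleNr -scalerN.
move: kv; rewrite addr_eq0 => /eqP <-.
by rewrite scalerA mulVf ?scale1r // qval_neq0.
Qed.

End Elimination.

(** * Sagle's identity and the Jacobian of the supercommutator *)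

Definition qsign (b : bool) : Q :=
  QArith_base.Qmake (if b then BinNums.Zneg BinNums.xH else BinNums.Zpos BinNums.xH) BinNums.xH.
Definition qint (z : BinNums.Z) : Q := QArith_base.Qmake z BinNums.xH.

(** The parity of a word, the letter i having parity e_i. *)
Fixpoint wpar (e : seq bool) (w : word nat) : bool :=
  match w with
  | Letter i => nth false e i
  | Join s t => wpar e s (+) wpar e t
  end.

(** The bilinear extension of [Join]. *)
Definition vmulw (u v : vec) : vec :=
  foldr (fun k r => foldr (fun l => vadd [:: (Join k.1 l.1, qmul k.2 l.2)]) r v) [::] u.

(** A word read as an iterated supercommutator, expanded into products. *)
Fixpoint expand (e : seq bool) (w : word nat) : vec :=
  match w with
  | Letter _ => [:: (w, qsign false)]
  | Join s t =>
      let u := expand e s in let v := expand e t in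
      vadd (vmulw u v)
        (vscale (qsign (~~ (wpar e s && wpar e t))) (vmulw v u))
  end.

(** (u, v, w) + ksign (v, u, w) if left holds, and (u, v, w) + ksign (u, w, v) otherwise. *)
Definition skew_vec (e : seq bool) (left : bool) (u v w : word nat) : vec :=
  let assoc c p q r := [:: (Join (Join p q) r, qsign c); (Join p (Join q r), qsign (~~ c))] in
  foldr (fun x => vadd [:: x]) [::]
   (if left then assoc false u v w ++ assoc (wpar e u && wpar e v) v u w
    else assoc false u v w ++ assoc (wpar e v && wpar e w) u w v).

(** The consequences of the skew-symmetry of the associator that are multilinear in four
    letters, for the orders ss of the letters. *)
Definition skew_relations (ss : seq (seq nat)) (e : seq bool) : seq vec :=
  flatten [seq
    let x i := Letter (nth 0%N s i) in
    flatten [seq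
      [:: skew_vec e b (Join (x 0%N) (x 1%N)) (x 2) (x 3);
          skew_vec e b (x 0%N) (Join (x 1%N) (x 2)) (x 3);
          skew_vec e b (x 0%N) (x 1%N) (Join (x 2) (x 3));
          [seq (Join k.1 (x 3), k.2) | k <- skew_vec e b (x 0%N) (x 1%N) (x 2)];
          [seq (Join (x 3) k.1, k.2) | k <- skew_vec e b (x 0%N) (x 1%N) (x 2)]]
      | b <- [:: true; false]]
   | s <- ss].

(** The skew-symmetry of the associator in three letters, for the orders ss. *)
Definition skew_relations3 (ss : seq (seq nat)) (e : seq bool) : seq vec :=
  flatten [seq
    let x i := Letter (nth 0%N s i) in
    [:: skew_vec e true (x 0%N) (x 1%N) (x 2); skew_vec e false (x 0%N) (x 1%N) (x 2)]
   | s <- ss].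

(** The expansion of a signed sum of iterated supercommutators. *)
Definition wcomb (l : seq (bool * word nat)) (e : seq bool) : vec :=
  foldr (fun k => vadd (vscale (qsign k.1) (expand e k.2))) [::] l.

(** The difference of the two sides of Sagle's identity
    [[x, z], [y, t]] = [[[x, y], z], t] + (cyclic permutations of x, y, z, t), with the signs
    of the super-version; the booleans tell the negative terms. *)
Definition sagle_words (e : seq bool) : seq (bool * word nat) :=
  let x := Letter 0%N in let y := Letter 1%N in let z := Letter 2 in let t := Letter 3 in
  let i := wpar e x in let j := wpar e y in let k := wpar e z in let l := wpar e t in
  [:: (j && k, Join (Join x z) (Join y t));
      (true, Join (Join (Join x y) z) t);
      (~~ (i && (j (+) k (+) l)), Join (Join (Join y z) t) x);
      (~~ ((i (+) j) && (k (+) l)), Join (Join (Join z t) x) y);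
      (~~ (l && (i (+) j (+) k)), Join (Join (Join t x) y) z)].

Definition sagle_check (e : seq bool) : bool :=
  nilp (vred fuel (foldl (fun m v => relate v m) RLeaf
             (skew_relations (permutations [:: 0; 1; 2; 3]%N) e))
             (wcomb (sagle_words e) e)).

(** The super-Jacobian of three letters. *)
Definition jacobi_words (e : seq bool) : seq (bool * word nat) :=
  let x := Letter 0%N in let y := Letter 1%N in let z := Letter 2 in
  let i := wpar e x in let j := wpar e y in let k := wpar e z in
  [:: (false, Join (Join x y) z);
      (i && (j (+) k), Join (Join y z) x);
      (k && (i (+) j), Join (Join z x) y)].

Definition six_assoc : vec :=
  let x := Letter 0%N in let y := Letter 1%N in let z := Letter 2 in
  vadd [:: (Join (Join x y) z, qint (BinInt.Z.of_nat 6))]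
       [:: (Join x (Join y z), qint (BinInt.Z.opp (BinInt.Z.of_nat 6)))].

Definition jacobi_check (e : seq bool) : bool :=
  nilp (vred fuel (foldl (fun m v => relate v m) RLeaf
             (skew_relations3 (permutations [:: 0; 1; 2]%N) e))
          (vadd (wcomb (jacobi_words e) e)
                (vscale (qsign true) six_assoc))).

Section Expansion.
Variables (F : fieldType) (charF0 : [pchar F] =i pred0).
Variables (A : superalgType F) (altA : alternative_superalgebra A).
Variables (e : seq bool) (h : nat -> A).
Hypothesis he : forall i, homogeneous (nth false e i) (h i).

Local Notation br := (@scommutator F A).
Local Notation assoc := (associator (@smul F A)).
Local Notation ev := (veval (word_eval h)).

(** The value of a word read as an iterated supercommutator. *)
Fixpoint br_eval (w : word nat) : A :=
  match w with
  | Letter i => h i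
  | Join s t => br (br_eval s) (br_eval t)
  end.

Lemma qval_sign b : qval F (qsign b) = (-1) ^+ b.
Proof.
have one : zval F (BinNums.Zpos BinNums.xH) = 1 by rewrite /zval /= mulr1z.
by case: b; rewrite /qval /= ?zval_neg one divr1 ?expr1.
Qed.

Lemma homogeneous_word w : homogeneous (wpar e w) (word_eval h w).
Proof. by elim: w => [i|s hs t ht] /=; [apply: he|apply: homogeneousM]. Qed.

Lemma homogeneous_br_eval w : homogeneous (wpar e w) (br_eval w).
Proof. by elim: w => [i|s hs t ht] /=; [apply: he|apply: homogeneous_scommutator]. Qed.

Lemma veval_foldr (V : lmodType F) (val : word nat -> V) (v w : vec) : 
  veval val (foldr (fun x => vadd [:: x]) w v) = veval val v + veval val w.
Proof.
elim: v => [|[k c] v IHv] /=; first by rewrite veval_nil add0r.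
by rewrite (vevalD charF0) IHv !veval_cons veval_nil addr0 addrA.
Qed.

Lemma smul_sumr (I : Type) (r : seq I) u (f : I -> A) :
  smul u (\sum_(i <- r) f i) = \sum_(i <- r) smul u (f i).
Proof. by apply: (big_morph _ (smulDr u) (smul0r u)). Qed.

Lemma smul_suml (I : Type) (r : seq I) u (f : I -> A) :
  smul (\sum_(i <- r) f i) u = \sum_(i <- r) smul (f i) u.
Proof. by apply: (big_morph _ (smulDl u) (smul0l u)). Qed.

Lemma veval_mulw u v : ev (vmulw u v) = smul (ev u) (ev v).
Proof.
elim: u => [|[k c] u IHu]; first by rewrite /= veval_nil smul0l.
rewrite veval_cons smulDl -IHu {1}/vmulw /= -/(vmulw u v).
elim: v (vmulw u v) {IHu} => [|[l d] v IHv] r /=.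
  by rewrite veval_nil smul0r add0r.
rewrite (vevalD charF0) IHv !veval_cons veval_nil addr0 smulDr addrA.
by congr (_ + _ + _); rewrite (qvalM charF0) smulZl smulZr scalerA.
Qed.

Lemma veval_expand w : ev (expand e w) = br_eval w.
Proof.
elim: w => [i|s IHs t IHt] /=.
  by rewrite veval_cons veval_nil addr0 qval_sign expr0 scale1r.
rewrite (vevalD charF0) (vevalZ charF0) !veval_mulw IHs IHt qval_sign.
rewrite (scommutatorE (homogeneous_br_eval s) (homogeneous_br_eval t)) /ksign.
by case: (_ && _); rewrite /= ?expr0 ?expr1 ?scaleN1r ?opprK !scale1r.
Qed.

Lemma veval_skew left u v w : ev (skew_vec e left u v w) = 0.
Proof.
have hu := homogeneous_word u; have hv := homogeneous_word v; have hw := homogeneous_word w.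
rewrite /skew_vec veval_foldr veval_nil addr0.
have signE (b : bool) p q r : (-1) ^+ b *: word_eval h (Join (Join p q) r)
    + (-1) ^+ (~~ b) *: word_eval h (Join p (Join q r))
    = (-1 : F) ^+ b *: assoc (word_eval h p) (word_eval h q) (word_eval h r).
  by rewrite scalerBr; case: b; rewrite /= ?expr0 ?expr1 !(scaleN1r, scale1r, opprK).
case: left; rewrite /veval !big_cons big_nil /= addr0 !qval_sign addrA !signE expr0 scale1r.
  rewrite (associatorC_l altA hu hv hw) scalerN scalerA.
  by rewrite -/(ksign F (wpar e u) (wpar e v)) ksignK scale1r subrr.
rewrite (associatorC_r altA hu hv hw) scalerN scalerA.
by rewrite -/(ksign F (wpar e v) (wpar e w)) ksignK scale1r subrr.
Qed.

Lemma veval_joinl (t : word nat) v :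
  ev [seq (Join k.1 t, k.2) | k <- v] = smul (ev v) (word_eval h t).
Proof.
rewrite /veval big_map smul_suml; apply: eq_bigr => k _ /=.
by rewrite smulZl.
Qed.

Lemma veval_joinr (t : word nat) v :
  ev [seq (Join t k.1, k.2) | k <- v] = smul (word_eval h t) (ev v).
Proof.
rewrite /veval big_map smul_sumr; apply: eq_bigr => k _ /=.
by rewrite smulZr.
Qed.

Fixpoint null_vecs (r : seq vec) : Prop :=
  if r is v :: r' then ev v = 0 /\ null_vecs r' else True.

Lemma null_vecs_flatten (T : Type) (f : T -> seq vec) (s : seq T) :
  (forall t, null_vecs (f t)) -> null_vecs (flatten [seq f t | t <- s]).
Proof.
move=> nf; elim: s => [//|t s IHs] /=.
by elim: (f t) (nf t) => [//|v r IHr] /= [v0 /IHr].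
Qed.

Lemma sound_relate_all r m : null_vecs r -> sound (F := F) (word_eval h) m ->
  sound (F := F) (word_eval h) (foldl (fun m v => relate v m) m r).
Proof.
elim: r m => [//|v r IHr] m /= [v0 r0] sm; apply: IHr => //.
exact: (sound_relate charF0).
Qed.

Lemma sound_skew_relations ss :
  sound (F := F) (word_eval h)
    (foldl (fun m v => relate v m) RLeaf (skew_relations ss e)).
Proof.
suff nr : null_vecs (skew_relations ss e) by exact: (@sound_relate_all _ RLeaf nr I).
apply: null_vecs_flatten => s; apply: null_vecs_flatten => b.
do !split; rewrite ?veval_skew ?veval_joinl ?veval_joinr ?veval_skew ?smul0l ?smul0r //.
Qed.

Lemma sound_skew_relations3 ss :
  sound (F := F) (word_eval h)
    (foldl (fun m v => relate v m) RLeaf (skew_relations3 ss e)).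
Proof.
suff nr : null_vecs (skew_relations3 ss e) by exact: (@sound_relate_all _ RLeaf nr I).
by apply: null_vecs_flatten => s; do !split; rewrite veval_skew.
Qed.

Lemma qval_int n : qval F (qint (BinInt.Z.of_nat n)) = n%:R.
Proof.
have one : zval F (BinNums.Zpos BinNums.xH) = 1 by rewrite /zval /= mulr1z.
rewrite /qval /= one divr1; case: n => [|n]; first by rewrite zval0.
by rewrite /zval /= Pnat.SuccNat2Pos.id_succ.
Qed.

Lemma veval_wcomb l : ev (wcomb l e) = \sum_(k <- l) (-1) ^+ k.1 *: br_eval k.2.
Proof.
elim: l => [|[b w] l IHl] /=; first by rewrite veval_nil big_nil.
by rewrite (vevalD charF0) (vevalZ charF0) IHl big_cons veval_expand qval_sign.
Qed.

End Expansion.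

Definition bools4 : seq (seq bool) :=
  [seq i :: e | i <- [:: true; false], e <- [seq j :: e | j <- [:: true; false],
    e <- [seq [:: k; l] | k <- [:: true; false], l <- [:: true; false]]]].

Lemma sagle_checked : all sagle_check bools4.
Proof. by vm_compute. Qed.

Definition bools3 : seq (seq bool) :=
  [seq i :: e | i <- [:: true; false],
    e <- [seq [:: k; l] | k <- [:: true; false], l <- [:: true; false]]].

Lemma jacobi_checked : all jacobi_check bools3.
Proof. by vm_compute. Qed.

Section Sagle.
Variables (F : fieldType) (charF0 : [pchar F] =i pred0).
Variables (A : superalgType F) (altA : alternative_superalgebra A).
Implicit Types (i j k l : bool) (x y z t : A).
Local Notation br := (@scommutator F A).

(** The supercommutators of an alternative superalgebra satisfy the super-version of Sagle's
    identity, that is, they form a Malcev superalgebra. *)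
Lemma super_sagle i j k l x y z t :
  homogeneous i x -> homogeneous j y -> homogeneous k z -> homogeneous l t ->
  ksign F j k *: br (br x z) (br y t) =
    br (br (br x y) z) t
    + (ksign F i (j (+) k (+) l) *: br (br (br y z) t) x
    + (ksign F (i (+) j) (k (+) l) *: br (br (br z t) x) y
    + ksign F l (i (+) j (+) k) *: br (br (br t x) y) z)).
Proof.
move=> hx hy hz ht; pose e := [:: i; j; k; l].
pose h n := nth 0 [:: x; y; z; t] n.
have he n : homogeneous (nth false e n) (h n).
  by case: n => [|[|[|[|n]]]] //; rewrite /h /= !nth_nil; apply: homogeneous0.
have ce : sagle_check e.
  by apply: (allP sagle_checked); rewrite /e; case: (i) (j) (k) (l) => [] [] [] [].
have := veval_red (F := F) charF0 fuel (wcomb (sagle_words e) e)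
  (sound_skew_relations charF0 altA he (permutations [:: 0; 1; 2; 3]%N)).
rewrite (nilP ce) veval_nil (veval_wcomb charF0 he) !big_cons big_nil /= => /eqP.
have signN (b : bool) (u : A) : (-1) ^+ (~~ b) *: u = - ((-1 : F) ^+ b *: u).
  by case: b; rewrite /= ?expr0 ?expr1 !(scaleN1r, scale1r, opprK).
rewrite addr0 !signN expr1 scaleN1r -!opprD eq_sym subr_eq0 => /eqP E.
exact: E.
Qed.

(** The super-Jacobian is six times the associator. *)
Lemma super_jacobi i j k x y z :
  homogeneous i x -> homogeneous j y -> homogeneous k z ->
  br (br x y) z + (ksign F i (j (+) k) *: br (br y z) x
    + ksign F k (i (+) j) *: br (br z x) y) = 6%:R *: associator (@smul F A) x y z.
Proof.
move=> hx hy hz; pose e := [:: i; j; k].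
pose h n := nth 0 [:: x; y; z] n.
have he n : homogeneous (nth false e n) (h n).
  by case: n => [|[|[|n]]] //; rewrite /h /= !nth_nil; apply: homogeneous0.
have ce : jacobi_check e.
  by apply: (allP jacobi_checked); rewrite /e; case: (i) (j) (k) => [] [] [].
have := veval_red (F := F) charF0 fuel
  (vadd (wcomb (jacobi_words e) e) (vscale (qsign true) six_assoc))
  (sound_skew_relations3 charF0 altA he (permutations [:: 0; 1; 2]%N)).
rewrite (nilP ce) veval_nil (vevalD charF0) (veval_wcomb charF0 he) (vevalZ charF0).
rewrite /six_assoc (vevalD charF0) !veval_cons !veval_nil !addr0 qval_sign.
rewrite !big_cons big_nil /= addr0 expr1 scaleN1r.
move=> /eqP; rewrite expr0 scale1r eq_sym subr_eq0 => /eqP ->.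
pose six := BinNums.xO (BinNums.xI BinNums.xH).
have q6 : qval F (qint (BinNums.Zpos six)) = 6%:R := qval_int F 6%N.
have n6 : qval F (qint (BinNums.Zneg six)) = - 6%:R by rewrite -q6 -qvalN.
by rewrite q6 n6 scaleNr -scalerBr.
Qed.

End Sagle.

(** * Consequences of Sagle's identity *)

(* In this part the words stand for iterated supercommutators. *)

(** The bracket [s, t] times c, with its arguments in decreasing order. *)
Definition vbr (e : seq bool) (s t : word nat) (c : Q) : vec :=
  match wcmp s t with
  | Gt => [:: (Join s t, c)]
  | Lt => [:: (Join t s, if wpar e s && wpar e t then c else qopp c)]
  | Eq => if wpar e s then [:: (Join s s, c)] else [::]
  end.

(** The bracket of two combinations, reduced by the rules m. *)
Definition vbracket (e : seq bool) (m : rules) (u v : vec) : vec :=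
  vred fuel m
   (foldr (fun k r => foldr (fun l => vadd (vbr e k.1 l.1 (qmul k.2 l.2))) r v) [::] u).

(** Sagle's identity at four iterated supercommutators, reduced by the rules m. *)
Definition sagle_vec (e : seq bool) (m : rules) (x y z t : word nat) : vec :=
  let X := [:: (x, qsign false)] in let Y := [:: (y, qsign false)] in
  let Z := [:: (z, qsign false)] in let T := [:: (t, qsign false)] in
  let i := wpar e x in let j := wpar e y in let k := wpar e z in let l := wpar e t in
  let b := vbracket e m in
  vadd (vscale (qsign (j && k)) (b (b X Z) (b Y T)))
  (vadd (vscale (qsign true) (b (b (b X Y) Z) T))
  (vadd (vscale (qsign (~~ (i && (j (+) k (+) l)))) (b (b (b Y Z) T) X))
  (vadd (vscale (qsign (~~ ((i (+) j) && (k (+) l)))) (b (b (b Z T) X) Y))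
        (vscale (qsign (~~ (l && (i (+) j (+) k)))) (b (b (b T X) Y) Z))))).

(** The reduced form of an iterated supercommutator. *)
Fixpoint vnorm (e : seq bool) (m : rules) (w : word nat) : vec :=
  match w with
  | Letter _ => [:: (w, qsign false)]
  | Join s t => vbracket e m (vnorm e m s) (vnorm e m t)
  end.

(** The reduced form of the super-Jacobian, which is six times the associator. *)
Definition vjac (e : seq bool) (m : rules) (u v w : word nat) : vec :=
  let i := wpar e u in let j := wpar e v in let k := wpar e w in
  vadd (vnorm e m (Join (Join u v) w))
  (vadd (vscale (qsign (i && (j (+) k))) (vnorm e m (Join (Join v w) u)))
        (vscale (qsign (k && (i (+) j))) (vnorm e m (Join (Join w u) v)))).

(** Six times a combination of associators. *)
Definition vjacs (e : seq bool) (m : rules)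
    (l : seq (BinNums.Z * (word nat * word nat * word nat))) : vec :=
  foldr (fun k => vadd (vscale (qint k.1) (vjac e m k.2.1.1 k.2.1.2 k.2.2))) [::] l.

(** The letter 0 stands for the odd element x, the letters 1 and 2 for even elements p and
    q. The list contains the iterated supercommutators that are substituted below; each of
    them is the bracket of two earlier ones, given by their positions. *)
Definition subwords : seq (word nat) :=
  foldl (fun ws k => rcons ws
      (Join (nth (Letter 0%N) ws k.1) (nth (Letter 0%N) ws k.2)))
    [:: Letter 0%N; Letter 1%N; Letter 2]
  [:: (0,0); (1,0); (2,0); (2,1); (3,0); (3,1); (3,2); (4,0); (4,2); (5,0); (5,1); (6,0);
   (7,0); (7,1); (7,2); (8,0); (9,0); (9,1); (10,0); (10,2); (11,0); (12,0); (12,1);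
   (13,0); (14,0); (15,0); (15,1); (15,2); (16,0); (17,0); (17,1); (18,0); (18,2);
   (19,0); (19,1); (20,0); (21,0); (21,2); (22,0); (23,0); (24,0); (24,1); (25,0);
   (26,0); (27,0); (28,0); (28,1); (28,2); (31,0); (32,0); (32,1); (33,0); (34,0);
   (35,0); (36,0); (36,1); (37,0); (38,0); (39,0); (40,0); (41,0); (42,0); (43,0);
   (43,1); (44,0); (45,0); (46,0); (47,0); (15,3); (21,3); (24,3); (27,3)]%N.

(** The substitutions (x, y, z, t) in Sagle's identity that the proof of
    [malcev_identities] needs: the first argument is x itself, the three others are given by
    their positions in [subwords]. The order is that of the elimination. *)
Definition sagle_instances : seq (nat * nat * nat) :=
  [:: (0,1,2); (1,0,2); (0,2,1); (0,0,2); (0,0,1); (0,0,6); (0,1,5); (5,0,1); (0,5,1);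
   (1,2,3); (2,3,1); (0,2,4); (3,1,2); (4,0,2); (0,0,5); (0,2,3); (3,0,2); (0,0,4);
   (0,1,3); (3,0,1); (0,0,3); (0,0,11); (0,0,13); (0,0,14); (0,1,9); (0,1,12); (9,0,1);
   (12,0,1); (0,9,1); (0,12,1); (1,2,7); (2,7,1); (0,2,8); (0,2,10); (7,1,2); (8,0,2);
   (10,0,2); (0,8,2); (0,10,2); (1,7,2); (0,6,3); (5,0,4); (0,4,5); (1,3,5); (0,0,9);
   (0,0,12); (0,2,7); (7,0,2); (0,7,2); (5,0,3); (0,0,8); (0,0,10); (0,1,7); (7,0,1);
   (0,7,1); (4,0,3); (0,0,7); (0,0,20); (0,0,22); (0,0,23); (0,0,25); (0,0,26);
   (0,0,27); (0,1,17); (0,1,19); (0,1,24); (17,0,1); (19,0,1); (24,0,1); (0,17,1);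
   (0,19,1); (0,24,1); (1,2,15); (2,15,1); (0,2,16); (0,2,18); (0,2,21); (15,1,2);
   (16,0,2); (18,0,2); (21,0,2); (0,16,2); (0,18,2); (0,21,2); (1,15,2); (2,1,15);
   (0,6,7); (7,0,6); (0,7,6); (11,0,3); (13,0,3); (14,0,3); (4,0,9); (4,0,12); (5,0,8);
   (5,0,10); (0,8,5); (0,9,4); (0,10,5); (0,11,3); (0,12,4); (0,13,3); (0,4,9);
   (0,4,12); (0,5,8); (0,0,17); (0,0,19); (0,0,24); (0,2,15); (15,0,2); (0,15,2);
   (3,0,9); (3,0,12); (5,0,7); (0,7,5); (0,9,3); (0,0,16); (0,0,18); (0,0,21);
   (0,1,15); (15,0,1); (0,15,1); (3,0,8); (3,0,10); (4,0,7); (0,7,4); (0,8,3);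
   (0,0,15); (3,0,7); (0,0,33); (0,0,35); (0,0,37); (0,0,38); (0,0,40); (0,0,41);
   (0,0,42); (0,0,44); (0,0,45); (0,0,46); (0,0,47); (0,1,30); (0,1,32); (0,1,36);
   (0,1,43); (30,0,1); (32,0,1); (36,0,1); (43,0,1); (0,30,1); (0,32,1); (0,36,1);
   (0,43,1); (1,2,28); (2,28,1); (28,1,2); (29,0,2); (31,0,2); (34,0,2); (39,0,2);
   (0,29,2); (0,31,2); (0,34,2); (0,39,2); (1,28,2); (2,1,28); (0,6,15); (15,0,6);
   (0,15,6); (3,0,20); (3,0,22); (3,0,23); (3,0,25); (3,0,26); (3,0,27); (4,0,17);
   (4,0,19); (4,0,24); (5,0,16); (5,0,18); (5,0,21); (0,16,5); (0,17,4); (0,18,5);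
   (0,19,4); (0,20,3); (0,21,5); (0,22,3); (0,23,3); (0,24,4); (0,25,3); (0,26,3);
   (0,27,3); (0,4,17); (0,4,19); (0,4,24); (0,5,16); (0,5,18); (0,5,21); (1,15,5);
   (5,1,15); (1,17,3); (3,1,17); (1,19,3); (3,1,19); (1,24,3); (3,1,24); (1,5,15);
   (15,1,5); (15,5,1); (2,15,4); (4,2,15); (6,7,3); (0,0,30); (0,0,32); (0,0,36);
   (0,0,43); (0,2,28); (28,0,2); (0,28,2); (3,0,17); (3,0,19); (3,0,24); (5,0,15);
   (0,15,5); (0,17,3); (0,19,3); (0,24,3); (0,5,15); (2,15,3); (3,2,15); (7,3,5);
   (0,0,29); (0,0,31); (0,0,34); (0,0,39); (0,1,28); (28,0,1); (0,28,1); (3,0,16);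
   (3,0,18); (3,0,21); (4,0,15); (0,15,4); (0,16,3); (0,18,3); (0,21,3); (0,4,15);
   (1,15,3); (3,1,15); (7,3,4); (0,0,53); (0,0,54); (0,0,56); (0,0,58); (0,0,59);
   (0,0,60); (0,0,62); (0,0,63); (0,0,64); (0,0,66); (0,0,67); (0,0,68); (0,0,69);
   (0,0,70); (0,0,74); (0,1,52); (0,1,57); (0,1,65); (50,0,1); (52,0,1); (57,0,1);
   (65,0,1); (73,0,1); (0,50,1); (0,52,1); (0,57,1); (0,65,1); (0,73,1); (1,2,48);
   (2,48,1); (1,2,71); (2,71,1); (48,1,2); (49,0,2); (51,0,2); (55,0,2); (61,0,2);
   (71,1,2); (72,0,2); (0,49,2); (0,51,2); (0,55,2); (0,61,2); (0,72,2); (1,48,2);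
   (1,71,2); (2,1,48); (2,1,71); (0,6,28); (28,0,6); (0,28,6); (3,0,33); (3,0,35);
   (3,0,37); (3,0,38); (3,0,40); (3,0,41); (3,0,42); (3,0,44); (3,0,45); (3,0,46);
   (3,0,47); (4,0,30); (4,0,32); (4,0,36); (4,0,43); (5,0,29); (5,0,31); (5,0,34);
   (5,0,39); (0,29,5); (0,30,4); (0,31,5); (0,32,4); (0,33,3); (0,34,5); (0,35,3);
   (0,36,4); (0,37,3); (0,38,3); (0,39,5); (0,40,3); (0,41,3); (0,42,3); (0,43,4);
   (0,44,3); (0,45,3); (0,46,3); (0,47,3); (0,4,30); (0,4,32); (0,4,36); (0,4,43);
   (1,28,5); (5,1,28); (1,30,3); (3,1,30); (1,32,3); (1,36,3); (1,43,3); (3,1,43);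
   (1,5,28); (28,1,5); (2,28,4); (3,6,15); (16,3,5); (18,3,5); (20,0,7); (21,3,5);
   (22,0,7); (25,0,7); (10,0,24)]%N.

Definition parities : seq bool := [:: true; false; false].

(** The rules that follow from the substitutions of the list l in Sagle's identity. *)
Definition sagle_rules (l : seq (nat * nat * nat)) : rules :=
  foldl (fun m k => relate (sagle_vec parities m (Letter 0%N)
      (nth (Letter 0%N) subwords k.1.1) (nth (Letter 0%N) subwords k.1.2)
      (nth (Letter 0%N) subwords k.2)) m) RLeaf l.

(** [w, x, ..., x] with n letters x. *)
Definition chain (w : word nat) (n : nat) : word nat := iter n (fun v => Join v (Letter 0%N)) w.

(* c (p_i, q_j, x) *)
Definition tterm (c : BinNums.Z) (i j : nat) : BinNums.Z * (word nat * word nat * word nat) :=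
  (c, (chain (Letter 1%N) i, chain (Letter 2) j, Letter 0%N)).

(* c times the element [tdefect] i j defined below *)
Definition fterm (c : BinNums.Z) (i j : nat) :=
  [:: tterm (if odd j then BinInt.Z.opp c else c) i.+1 j; tterm c i j.+1].

(* c times the value of the form [gform] defined below at (p_i, q_j) *)
Definition gterm (c : BinNums.Z) (i j : nat) :=
  let p := chain (Letter 1%N) i in let q := chain (Letter 2) j in
  let x := Letter 0%N in let x2 := Join x x in
  [:: (c, (Join p q, x2, x)); (c, (Join x2 x, p, q))].

Notation Zn n := (BinInt.Z.of_nat n).

Definition malcev_check : bool :=
  let m := sagle_rules sagle_instances in
  all (fun l => nilp (vjacs parities m l))
    [:: fterm (Zn 2) 2 1 ++ fterm (Zn 2) 1 2 ++ gterm (Zn 1) 2 0 ++ gterm (Zn 1) 0 2;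
        fterm (Zn 2) 2 3 ++ fterm (Zn 5) 1 4;
        fterm (Zn 2) 3 2 ++ fterm (Zn 5) 1 4;
        fterm (Zn 1) 4 1 ++ fterm (BinInt.Z.opp (Zn 1)) 1 4].

Lemma malcev_checked : malcev_check.
Proof. by vm_compute. Qed.

Section Brackets.
Variables (F : fieldType) (charF0 : [pchar F] =i pred0).
Variables (A : superalgType F) (altA : alternative_superalgebra A).
Implicit Types (i j : bool) (u v : A).
Local Notation br := (@scommutator F A).

Lemma scommutatorDl v : {morph br^~ v : u u' / u + u'}.
Proof.
move=> u u'; rewrite /scommutator -big_split /=; apply: eq_bigr => i _.
rewrite -big_split /=; apply: eq_bigr => j _.
by rewrite spartD smulDl smulDr scalerDr opprD addrACA.
Qed.
Lemma scommutatorDr u : {morph br u : v v' / v + v'}.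
Proof.
move=> v v'; rewrite /scommutator -big_split /=; apply: eq_bigr => i _.
rewrite -big_split /=; apply: eq_bigr => j _.
by rewrite spartD smulDl smulDr scalerDr opprD addrACA.
Qed.
Lemma scommutatorZl c u v : br (c *: u) v = c *: br u v.
Proof.
rewrite /scommutator scaler_sumr; apply: eq_bigr => i _.
rewrite scaler_sumr; apply: eq_bigr => j _.
by rewrite spartZ smulZl smulZr scalerBr !scalerA [c * _]mulrC.
Qed.
Lemma scommutatorZr c u v : br u (c *: v) = c *: br u v.
Proof.
rewrite /scommutator scaler_sumr; apply: eq_bigr => i _.
rewrite scaler_sumr; apply: eq_bigr => j _.
by rewrite spartZ smulZl smulZr scalerBr !scalerA [c * _]mulrC.
Qed.
Lemma scommutator0l v : br 0 v = 0.
Proof. by apply: (addrI (br 0 v)); rewrite -scommutatorDl !addr0. Qed.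
Lemma scommutator0r u : br u 0 = 0.
Proof. by apply: (addrI (br u 0)); rewrite -scommutatorDr !addr0. Qed.

Lemma scommutatorC i j u v : homogeneous i u -> homogeneous j v ->
  br v u = - (ksign F i j *: br u v).
Proof.
move=> hu hv; rewrite (scommutatorE hu hv) (scommutatorE hv hu).
by rewrite scalerBr scalerA ksignK scale1r opprB ksignC.
Qed.

(** The value of a combination of associators of iterated supercommutators. *)
Definition jsum (h : nat -> A) (l : seq (BinNums.Z * (word nat * word nat * word nat))) : A :=
  \sum_(k <- l) qval F (qint k.1) *:
    associator (@smul F A) (br_eval h k.2.1.1) (br_eval h k.2.1.2) (br_eval h k.2.2).

Section Normal.
Variables (e : seq bool) (h : nat -> A).
Hypothesis he : forall n, homogeneous (nth false e n) (h n).
Local Notation ev := (veval (br_eval h)).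
Local Notation hw := (homogeneous_br_eval he).

Lemma veval_vbr s t c : ev (vbr e s t c) = qval F c *: br (br_eval h s) (br_eval h t).
Proof.
rewrite /vbr; case E: (wcmp s t); rewrite ?veval_cons ?veval_nil ?addr0 //=.
  rewrite -(wcmp_eq E); have := scommutatorC (hw s) (hw s); rewrite /ksign andbb.
  case: ifP => /= ps; first by rewrite veval_cons veval_nil addr0.
  rewrite expr0 scale1r => /eqP; rewrite -addr_eq0 -mulr2n -scaler_nat scaler_eq0.
  by rewrite (iffLR (pcharf0P F) charF0) /= veval_nil => /eqP ->; rewrite scaler0.
rewrite (scommutatorC (hw s) (hw t)) /ksign scalerN scalerA.
by case: ifP; rewrite /= ?qvalN ?expr1 ?expr0 ?mulr1 ?mulrN1 ?scaleNr ?opprK.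
Qed.

Lemma veval_vbracket m (u v : vec) : sound (F := F) (br_eval h) m ->
  ev (vbracket e m u v) = br (ev u) (ev v).
Proof.
move=> sm; rewrite /vbracket (veval_red charF0) //.
elim: u => [|[k c] u IHu]; first by rewrite /= veval_nil scommutator0l.
rewrite veval_cons scommutatorDl -IHu /=.
elim: v (foldr _ _ u) {IHu} => [|[l d] v IHv] r /=.
  by rewrite veval_nil scommutator0r add0r.
rewrite (vevalD charF0) IHv veval_vbr veval_cons scommutatorDr addrA.
by congr (_ + _ + _); rewrite (qvalM charF0) scommutatorZl scommutatorZr scalerA.
Qed.

Lemma veval_letter (w : word nat) : ev [:: (w, qsign false)] = br_eval h w.
Proof. by rewrite veval_cons veval_nil addr0 qval_sign expr0 scale1r. Qed.

Lemma veval_sagle m x y z t : sound (F := F) (br_eval h) m ->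
  ev (sagle_vec e m x y z t) = 0.
Proof.
move=> sm; rewrite /sagle_vec !(vevalD charF0) !(vevalZ charF0) !veval_vbracket //.
rewrite !veval_letter !qval_sign.
have signN (b : bool) (u : A) : (-1) ^+ (~~ b) *: u = - ((-1 : F) ^+ b *: u).
  by case: b; rewrite /= ?expr0 ?expr1 !(scaleN1r, scale1r, opprK).
rewrite !signN expr1 scaleN1r -!opprD; apply/eqP; rewrite subr_eq0; apply/eqP.
exact: (super_sagle charF0 altA (hw x) (hw y) (hw z) (hw t)).
Qed.

Lemma veval_vnorm m (w : word nat) : sound (F := F) (br_eval h) m -> ev (vnorm e m w) = br_eval h w.
Proof.
by move=> sm; elim: w => [i|s IHs t IHt] /=; rewrite ?veval_letter // veval_vbracket // IHs IHt.
Qed.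

Lemma veval_vjac m (u v w : word nat) : sound (F := F) (br_eval h) m ->
  ev (vjac e m u v w) =
    6%:R *: associator (@smul F A) (br_eval h u) (br_eval h v) (br_eval h w).
Proof.
move=> sm; rewrite /vjac !(vevalD charF0) !(vevalZ charF0) !veval_vnorm // !qval_sign.
exact: (super_jacobi charF0 altA (hw u) (hw v) (hw w)).
Qed.

Lemma veval_vjacs m (l : seq (BinNums.Z * (word nat * word nat * word nat))) :
  sound (F := F) (br_eval h) m ->
  ev (vjacs e m l) = 6%:R *: jsum h l.
Proof.
move=> sm; rewrite /jsum; elim: l => [|k l IHl] /=; first by rewrite big_nil scaler0 veval_nil.
rewrite (vevalD charF0) (vevalZ charF0) IHl veval_vjac // big_cons [RHS]scalerDr.
by congr (_ + _); rewrite !scalerA [_ * 6%:R]mulrC.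
Qed.

End Normal.

Section Malcev.
Variables (p q x : A).
Hypotheses (hp : homogeneous false p) (hq : homogeneous false q) (hx : homogeneous true x).

Let h n := nth 0 [:: x; p; q] n.
Let he n : homogeneous (nth false parities n) (h n).
Proof. by case: n => [|[|[|n]]] //; rewrite /h /= !nth_nil; apply: homogeneous0. Qed.

Lemma sound_sagle_rules l : sound (F := F) (br_eval h) (sagle_rules l).
Proof.
rewrite /sagle_rules; have: sound (F := F) (br_eval h) RLeaf by [].
elim: l RLeaf => [//|k s IHs] m sm /=; apply: IHs.
exact/(sound_relate charF0)/veval_sagle.
Qed.

Lemma jsum_eq0 m l : sound (F := F) (br_eval h) m -> nilp (vjacs parities m l) ->
  jsum h l = 0.
Proof.
move=> sm /nilP nl; have := veval_vjacs he l sm.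
rewrite nl veval_nil => /esym/eqP; rewrite scaler_eq0.
by rewrite (iffLR (pcharf0P F) charF0) /= => /eqP.
Qed.

Local Notation T := (fun u v => associator (@smul F A) u v x).
Local Notation "p @ i" := (scomm_iter x p i) (at level 20).

Lemma br_eval_chain w n : br_eval h (chain w n) = (br_eval h w) @ n.
Proof. by elim: n => [//|n IHn]; rewrite /chain /scomm_iter !iterS /= -/(chain w n) IHn. Qed.

(** The failure of D = [_, x] to be skew with respect to the form T(u, v) = (u, v, x). *)
Definition tdefect (i j : nat) : A :=
  (-1) ^+ j *: T (p @ i.+1) (q @ j) + T (p @ i) (q @ j.+1).

(** The form that remains in the relation of smallest degree. *)
Definition gform u v : A :=
  associator (@smul F A) (br u v) (br x x) x + associator (@smul F A) (br (br x x) x) u v.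

Lemma jsum_fterm c (i j : nat) : jsum h (fterm c i j) = qval F (qint c) *: tdefect i j.
Proof.
rewrite /jsum !big_cons big_nil addr0 /= !br_eval_chain /= [RHS]scalerDr; congr (_ + _).
rewrite scalerA; congr (_ *: _); rewrite -signr_odd.
case: (odd j); rewrite ?mulr1 // expr1 mulrN1.
exact: (qvalN F (qint c)).
Qed.

Lemma jsum_gterm c (i j : nat) : jsum h (gterm c i j) = qval F (qint c) *: gform (p @ i) (q @ j).
Proof. by rewrite /jsum !big_cons big_nil addr0 /= !br_eval_chain /= [RHS]scalerDr. Qed.

Lemma jsum_cat l1 l2 : jsum h (l1 ++ l2) = jsum h l1 + jsum h l2.
Proof. by rewrite /jsum big_cat. Qed.

(** The relations among the values of T that are used below. They follow from Sagle's identity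
    and from the fact that the associator is a multiple of the Jacobian. *)
Lemma malcev_identities :
  [/\ 2%:R *: tdefect 2 1 + (2%:R *: tdefect 1 2 + (gform (p @ 2) q + gform p (q @ 2))) = 0,
      2%:R *: tdefect 2 3 + 5%:R *: tdefect 1 4 = 0,
      2%:R *: tdefect 3 2 + 5%:R *: tdefect 1 4 = 0
    & tdefect 4 1 = tdefect 1 4].
Proof.
have sm := sound_sagle_rules sagle_instances; have := malcev_checked.
rewrite /malcev_check /all; move: (sagle_rules _) sm => m sm.
case/and5P=> /(jsum_eq0 sm) e1 /(jsum_eq0 sm) e2 /(jsum_eq0 sm) e3 /(jsum_eq0 sm) e4 _.
have q1 : qval F (qint (Zn 1)) = 1 := qval_int F 1.
split.
- by move: e1; rewrite !jsum_cat !jsum_fterm !jsum_gterm !qval_int !scale1r.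
- by move: e2; rewrite !jsum_cat !jsum_fterm !qval_int.
- by move: e3; rewrite !jsum_cat !jsum_fterm !qval_int.
- move: e4; rewrite !jsum_cat !jsum_fterm.
  rewrite [qval _ (qint (BinInt.Z.opp _))](qvalN F (qint (Zn 1))) !qval_int.
  by rewrite scaleNr !scale1r => /eqP; rewrite subr_eq0 => /eqP.
Qed.

End Malcev.
End Brackets.

(** * Cyclic forms *)

(** [bc + cb, x] - b[c, x] - [c, x]b - c[b, x] + [b, x]c for b even and c, x odd, the letters
    being b, c, x in this order. *)
Definition jordan_words : seq (bool * word nat) :=
  let b := Letter 0%N in let c := Letter 1%N in let x := Letter 2 in
  [:: (false, Join (Join b c) x); (false, Join (Join c b) x);
      (false, Join x (Join b c)); (false, Join x (Join c b));
      (true, Join b (Join c x)); (true, Join b (Join x c));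
      (true, Join (Join c x) b); (true, Join (Join x c) b);
      (true, Join c (Join b x)); (false, Join c (Join x b));
      (false, Join (Join b x) c); (true, Join (Join x b) c)].

(** A signed sum of words. *)
Definition wmono (l : seq (bool * word nat)) : vec :=
  foldr (fun k => vadd [:: (k.2, qsign k.1)]) [::] l.

Lemma jordan_checked :
  nilp (vred fuel (foldl (fun m v => relate v m) RLeaf
          (skew_relations3 (permutations [:: 0; 1; 2]%N) [:: false; true; true]))
        (wmono jordan_words)).
Proof. by vm_compute. Qed.

Section Central.
Variables (F : fieldType) (charF0 : [pchar F] =i pred0).
Variables (A : superalgType F) (altA : alternative_superalgebra A).
Local Notation br := (@scommutator F A).
Local Notation assoc := (associator (@smul F A)).

Lemma mulrn_eq0 (u : A) n : u *+ n.+1 = 0 -> u = 0.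
Proof.
move=> /eqP; rewrite -scaler_nat scaler_eq0 (iffLR (pcharf0P F) charF0) /=.
by move=> /eqP.
Qed.

Lemma eqN_eq0 (u : A) : u = - u -> u = 0.
Proof. by move=> e; apply: (@mulrn_eq0 _ 1); rewrite mulr2n {2}e subrr. Qed.

Lemma associator_bb k b w : homogeneous false b -> homogeneous k w -> assoc b b w = 0.
Proof.
move=> hb hw; apply: eqN_eq0; rewrite {1}(associatorC_l altA hb hb hw).
by rewrite /ksign expr0 scale1r.
Qed.

Lemma associator_sqr k b w : homogeneous false b -> homogeneous k w ->
  assoc (smul b b) b w = 0.
Proof.
move=> hb hw; have hbb : homogeneous false (smul b b) by apply: (homogeneousM hb hb).
apply: eqN_eq0; rewrite -[X in - X]scale1r -[1](expr0 (-1 : F)).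
rewrite -(associatorC_l altA hbb hb hw) /associator.
have /eqP := associator_bb hb hb; rewrite subr_eq0 => /eqP ->.
have /eqP := associator_bb hb (homogeneousM hb hw); rewrite subr_eq0 => /eqP ->.
by have /eqP := associator_bb hb hw; rewrite subr_eq0 => /eqP ->.
Qed.

Lemma associator_sqrr k b w : homogeneous false b -> homogeneous k w ->
  assoc w (smul b b) b = 0.
Proof.
move=> hb hw; have hbb : homogeneous false (smul b b) by apply: (homogeneousM hb hb).
by rewrite (associatorC_r altA hw hb hbb) (associatorC_l altA hb hw hbb)
  (associatorC_r altA hb hbb hw) (associatorC_l altA hbb hb hw) (associator_sqr hb hw)
  !(scaler0, oppr0).
Qed.

Section Derivation.
Variable x : A.
Hypothesis hx : homogeneous true x.
Local Notation "p @ i" := (scomm_iter x p i) (at level 20).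

Lemma homogeneous_iter i u n : homogeneous i u -> homogeneous (odd n (+) i) (u @ n).
Proof.
move=> hu; elim: n => [//|n IHn].
have -> : odd n.+1 (+) i = (odd n (+) i) (+) true by rewrite /= addbT addNb.
exact: (homogeneous_scommutator IHn hx).
Qed.

Lemma scomm_iterD u m n : u @ (m + n) = (u @ n) @ m.
Proof. by rewrite /scomm_iter iterD. Qed.

Lemma scomm_iter_add n : {morph (fun u => u @ n) : u v / u + v}.
Proof. by elim: n => [//|n IHn] u v; rewrite /= IHn scommutatorDl. Qed.

Lemma derive_sqr b : homogeneous false b ->
  br (smul b b) x = smul b (br b x) + smul (br b x) b.
Proof.
move=> hb; have hbb : homogeneous false (smul b b) by apply: (homogeneousM hb hb).
rewrite (scommutatorE hbb hx) (scommutatorE hb hx) /ksign expr0 !scale1r.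
rewrite smulBr smulBl addrA.
have /eqP := associator_bb hb hx; rewrite subr_eq0 => /eqP ->.
have bxb : assoc b x b = 0.
  by rewrite (associatorC_r altA hb hb hx) (associator_bb hb hx) scaler0 oppr0.
have xbb : assoc x b b = 0.
  by rewrite (associatorC_l altA hb hx hb) bxb scaler0 oppr0.
move/eqP: bxb; rewrite subr_eq0 => /eqP ->; move/eqP: xbb; rewrite subr_eq0 => /eqP ->.
by rewrite subrK.
Qed.

Lemma veval_wmono (h : nat -> A) l :
  veval (word_eval h) (wmono l) = \sum_(k <- l) (-1 : F) ^+ k.1 *: word_eval h k.2.
Proof.
elim: l => [|k l IHl]; first by rewrite veval_nil big_nil.
rewrite /wmono /= -/(wmono l) (vevalD charF0) IHl big_cons veval_cons veval_nil addr0.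
by rewrite qval_sign.
Qed.

(* with c = [b, x], this turns [derive_sqr] into [derive2_sqr] *)
Lemma derive_jordan b c : homogeneous false b -> homogeneous true c ->
  br (smul b c + smul c b) x =
    smul b (br c x) + smul (br c x) b + (smul c (br b x) - smul (br b x) c).
Proof.
move=> hb hc; pose h n := nth 0 [:: b; c; x] n.
have he n : homogeneous (nth false [:: false; true; true] n) (h n).
  by case: n => [|[|[|n]]] //; rewrite /h /= !nth_nil; apply: homogeneous0.
have := veval_red (F := F) charF0 fuel (wmono jordan_words)
  (sound_skew_relations3 charF0 altA he (permutations [:: 0; 1; 2]%N)).
rewrite (nilP jordan_checked) veval_nil veval_wmono !big_cons big_nil /= addr0.
rewrite !expr0 !expr1 !scale1r !scaleN1r => E.
have hbc : homogeneous true (smul b c + smul c b).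
  by apply: homogeneousD; [apply: (homogeneousM hb hc)|apply: (homogeneousM hc hb)].
rewrite (scommutatorE hbc hx) (scommutatorE hc hx) (scommutatorE hb hx) /ksign /=.
rewrite expr0 expr1 !scale1r !scaleN1r !opprK !(smulDl, smulDr) !(smulNl, smulNr).
apply/eqP; rewrite -subr_eq0; apply/eqP; rewrite [RHS]E !opprD !opprK !addrA.
by [].
Qed.

(** The operator D^2 acts on the squares of even elements as a derivation. *)
Lemma derive2_sqr b : homogeneous false b ->
  (smul b b) @ 2 = smul b (b @ 2) + smul (b @ 2) b.
Proof.
move=> hb; rewrite /= (derive_sqr hb) derive_jordan ?subrr ?addr0 //.
exact: (homogeneous_scommutator hb hx).
Qed.

(** ** Biadditive maps that vanish at (bb, b) *)

(** The biadditive maps Phi with Phi(bb, b) = 0 for all even b. *)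
Record cyclic (Phi : A -> A -> A) : Prop := Cyclic {
  cyclicDl : forall v, {morph Phi^~ v : u u' / u + u'};
  cyclicDr : forall u, {morph Phi u : v v' / v + v'};
  cyclic_sqr : forall b, homogeneous false b -> Phi (smul b b) b = 0
}.

Lemma cyclicN Phi u v : cyclic Phi ->
  (Phi (- u) v = - Phi u v) * (Phi u (- v) = - Phi u v).
Proof.
move=> cP; have z0 w : Phi 0 w = 0.
  by apply: (addrI (Phi 0 w)); rewrite -(cyclicDl cP) !addr0.
have z1 w : Phi w 0 = 0.
  by apply: (addrI (Phi w 0)); rewrite -(cyclicDr cP) !addr0.
split; apply: (addrI (Phi u v)).
  by rewrite -(cyclicDl cP) !subrr z0.
by rewrite -(cyclicDr cP) !subrr z1.
Qed.

(** The identity Phi(bb, b) = 0 has as its linearization the vanishing of the sum of the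
    components of degrees (2, 1) and (1, 2) in b and c; replacing c by - c separates them. *)
Lemma cyclic_polar Phi b c : cyclic Phi -> homogeneous false b -> homogeneous false c ->
  Phi (smul b c + smul c b) b + Phi (smul b b) c = 0.
Proof.
move=> cP hb hc.
pose X b c := Phi (smul b c + smul c b) b + Phi (smul b b) c.
have XX d e : homogeneous false d -> homogeneous false e -> X d e = - X e d.
  move=> hd he; apply/eqP; rewrite -addr_eq0; apply/eqP.
  have := cyclic_sqr cP (homogeneousD hd he).
  rewrite smulDl !smulDr !(cyclicDl cP) !(cyclicDr cP) !(cyclic_sqr cP) //.
  rewrite /X !(cyclicDl cP) !add0r !addr0 => <-.
  by rewrite [LHS](AC (3*3) ((3*(1*5))*(2*4*6))).
have XN : X b (- c) = - X b c.
  by rewrite /X smulNl smulNr -opprD !(cyclicN _ _ cP) -opprD.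
have NX : X (- c) b = X c b.
  by rewrite /X smulNl smulNr -opprD smulNl smulNr opprK !(cyclicN _ _ cP) opprK.
apply: eqN_eq0; rewrite -/(X b c) {1}(XX b c hb hc) -NX.
by rewrite -(XX b (- c) hb (homogeneousN hc)) XN.
Qed.

(** The action of D^2 on forms. *)
Definition shift (Phi : A -> A -> A) u v := Phi (u @ 2) v + Phi u (v @ 2).

Lemma cyclic_shift Phi : cyclic Phi -> cyclic (shift Phi).
Proof.
move=> cP; split=> [v u u'|u v v'|b hb]; rewrite /shift.
- by rewrite scomm_iter_add !(cyclicDl cP) addrACA.
- by rewrite scomm_iter_add !(cyclicDr cP) addrACA.
- by rewrite (derive2_sqr hb); apply: (cyclic_polar cP hb (homogeneous_iter 2 hb)).
Qed.

Local Notation T := (fun u v => assoc u v x).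

Lemma cyclic_associator : cyclic T.
Proof.
split=> [v u u'|u v v'|b hb]; [exact: associatorDl|exact: associatorDm|].
exact: (associator_sqr hb hx).
Qed.

Lemma scommutator_sqr b : homogeneous false b -> br (smul b b) b = 0.
Proof.
move=> hb; rewrite (scommutatorE (homogeneousM hb hb) hb) /ksign expr0 scale1r.
exact: (associator_bb hb hb).
Qed.

Lemma cyclic_gform : cyclic (gform x).
Proof.
have hxx : homogeneous false (br x x) := homogeneous_scommutator hx hx.
have hxxx : homogeneous true (br (br x x) x) := homogeneous_scommutator hxx hx.
split=> [v u u'|u v v'|b hb]; rewrite /gform.
- by rewrite scommutatorDl associatorDl associatorDm addrACA.
- by rewrite scommutatorDr associatorDl associatorDr addrACA.
- rewrite (scommutator_sqr hb) (associator_sqrr hb hxxx) addr0.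
  by rewrite /associator !smul0l subrr.
Qed.

(** ** The interior defects vanish *)

Lemma tdefect_shiftl p q i j : tdefect p q x i.+2 j = tdefect (p @ 2) q x i j.
Proof. by rewrite /tdefect -!scomm_iterD !addn2. Qed.

Lemma tdefect_shiftr p q i j : tdefect p q x i j.+2 = tdefect p (q @ 2) x i j.
Proof. by rewrite /tdefect -!scomm_iterD !addn2 !exprS !mulN1r opprK. Qed.

Lemma scale_eq0 n (u : A) : n.+1%:R *: u = 0 -> u = 0.
Proof. by rewrite scaler_nat => /mulrn_eq0. Qed.

(** The relations of [malcev_identities] for (p, D^2 q) and (D^2 p, q) form a nonsingular
    linear system in the six defects with i + j = 7. The others reduce to these, by lowering
    i or j by two. *)
Lemma tdefect_interior p q i j : homogeneous false p -> homogeneous false q ->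
  (0 < i)%N -> (0 < j)%N -> odd (i + j) -> (7 <= i + j)%N -> tdefect p q x i j = 0.
Proof.
have [n le_n] := ubnP (i + j); elim: n => // n IHn in p q i j le_n *.
move=> hp hq i0 j0 oij; have hp2 : homogeneous false (p @ 2) := homogeneous_iter 2 hp.
have hq2 : homogeneous false (q @ 2) := homogeneous_iter 2 hq.
rewrite leq_eqVlt => /predU1P[ij7|ij7]; last first.
  have ij9 : (8 < i + j)%N by move: ij7 oij; rewrite leq_eqVlt => /predU1P[<-|].
  have [i3|i3] := leqP 3 i.
    case: i i3 i0 le_n oij ij7 ij9 => [|[|i]] // i3 _ le_n oij ij7 ij9.
    rewrite tdefect_shiftl; move: oij; rewrite !addSn /= negbK => oij.
    by apply: IHn => //; lia.
  have j3 : (3 <= j)%N by rewrite leqNgt; apply/negP => jl; move: ij9; lia.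
  case: j j3 j0 le_n oij ij7 ij9 => [|[|j]] // j3 _ le_n oij ij7 ij9.
  rewrite tdefect_shiftr; move: oij; rewrite !addnS /= negbK => oij.
  by apply: IHn => //; lia.
(* For i + j = 7: 2 F_25 + 5 F_16 = 2 F_34 + 5 F_16 = F_43 - F_16 = 0, and
   2 F_43 + 5 F_34 = 2 F_52 + 5 F_34 = F_61 - F_34 = 0. *)
have [_ a25 a34 a43] := malcev_identities charF0 altA hp hq2 hx.
have [_ b43 b52 b61] := malcev_identities charF0 altA hp2 hq hx.
move: a25 a34 a43 b43 b52 b61.
rewrite -!tdefect_shiftl -!tdefect_shiftr.
have key (f g : A) : 2%:R *: g + 5%:R *: f = 0 -> 2%:R *: f + 5%:R *: g = 0 -> f = 0.
  move=> gf fg; apply: (@scale_eq0 20).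
  have -> : 21%:R *: f = 5%:R *: (2%:R *: g + 5%:R *: f) - 2%:R *: (2%:R *: f + 5%:R *: g).
    rewrite !scalerDr !scalerA -!natrM [X in - X]addrC opprD addrACA subrr add0r.
    by rewrite -scalerBl -natrB.
  by rewrite gf fg !scaler0 subrr.
move=> a25 a34 a43; rewrite a43 => b43 b52 b61.
have f0 := key _ _ a34 b43; move: a25 a34 a43 b43 b52 b61.
rewrite f0 !scaler0 !addr0 => /scale_eq0 a25 /scale_eq0 a34 a43 _.
rewrite a34 scaler0 !addr0 => /scale_eq0 a52 a61.
clear IHn le_n oij; have ej : j = (7 - i)%N by rewrite ij7 addKn.
case: i i0 ij7 ej => [//|[|[|[|[|[|[|i]]]]]]] _ ij7 ej.
all: try by rewrite ej.
by move: j0; rewrite ej.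
Qed.

(** ** The boundary relation *)

(** The recurrence builds the sum of the W 0 i j with i + j = r + 2 and binomial
    coefficients. If the inner terms alternate in sign, each step cancels in the interior,
    and only the terms next to the two ends survive. *)
Lemma alternating_array (W : nat -> nat -> nat -> A) r :
  (forall k i j, W k.+1 i j = W k i.+1 j + W k i j.+1) ->
  (forall i j, (0 < i)%N -> (0 < j)%N -> (i + j = r.+1)%N -> W 0%N i.+1 j + W 0%N i j.+1 = 0) ->
  W r.+2 0%N 0%N =
    W 0%N r.+2 0%N + W 0%N r.+1 1%N + (W 0%N 1%N r.+1 + W 0%N 0%N r.+2).
Proof.
move=> WS W0; have interior k i j : (0 < i)%N -> (0 < j)%N -> (k + i + j = r.+1)%N ->
    W k.+1 i j = 0.
  elim: k i j => [|k IHk] i j i0 j0 E; rewrite WS; first exact: W0.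
  by rewrite !IHk ?addr0 // -E !addSnnS ?addnS.
have left k : (k <= r)%N -> W k.+1 (r.+1 - k)%N 0%N = W 1%N r.+1 0%N.
  elim: k => [|k IHk] kr; first by rewrite subn0.
  rewrite WS subSS -(subSn (ltnW kr)) (interior k _ 1%N) ?subn_gt0 //; last by lia.
  by rewrite addr0 IHk // ltnW.
have right k : (k <= r)%N -> W k.+1 0%N (r.+1 - k)%N = W 1%N 0%N r.+1.
  elim: k => [|k IHk] kr; first by rewrite subn0.
  rewrite WS subSS -(subSn (ltnW kr)) (interior k 1%N) ?subn_gt0 //; last by lia.
  by rewrite add0r IHk // ltnW.
by rewrite WS -[X in W r.+1 X _](subSnn r) left // -[X in W r.+1 _ X](subSnn r) right // !WS.
Qed.

Lemma cyclic_iter_shift Phi k : cyclic Phi -> cyclic (iter k shift Phi).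
Proof. by move=> cP; elim: k => //= k; apply: cyclic_shift. Qed.

Let zero_combination (V : zmodType) (s t u v w : V) :
  s + t + (t + w) = 0 -> - u + t + (t + v) = 0 -> s + w + u - v = 0.
Proof.
move=> st uv; rewrite -[RHS](subrr 0) -{1}st -uv !opprD !opprK.
by rewrite [RHS](AC ((2*2)*(2*2)) ((1*4*5*8)*(2*6)*(3*7))) /= !subrr !addr0.
Qed.

(** For m = 1 the defects of [tdefect_interior] are not available, and the relation comes from
    the first of [malcev_identities], whose additional terms form a value at (bb, b) of the
    shift of [gform]. For m > 1, T(p_(2i+2), b_(2j)) + T(p_(2i), b_(2j+2)) is the sum of the
    defects (2i + 1, 2j) and (2i, 2j + 1), hence zero for i, j > 0, and the vanishing of the
    defects (1, n - 2) and (n - 2, 1) rewrites the two terms next to the ends. *)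
Lemma boundary_relation b m : homogeneous false b -> (0 < m)%N ->
  let p := smul b b in let n := (4 * m)%N in
  T (p @ n) b + T p (b @ n) + T (p @ n.-1) (b @ 1) - T (p @ 1) (b @ n.-1) = 0.
Proof.
move=> hb m0 p; have hp : homogeneous false p := homogeneousM hb hb.
case: m m0 => [//|[_|m _]] n.
  rewrite {}/n /=.
  have [+ _ _ _] := malcev_identities charF0 altA hp hb hx.
  have -> : gform x (p @ 2) b + gform x p (b @ 2) = 0.
    exact: (cyclic_sqr (cyclic_shift cyclic_gform) hb).
  have T2 : T (p @ 4) b + T (p @ 2) (b @ 2) + (T (p @ 2) (b @ 2) + T p (b @ 4)) = 0.
    exact: (cyclic_sqr (cyclic_iter_shift 2 cyclic_associator) hb).
  rewrite addr0 -scalerDr => /scale_eq0; rewrite /tdefect expr1 sqrrN expr1n scaleN1r scale1r => E.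
  exact: zero_combination T2 E.
pose t i j := T (p @ i) (b @ j).
have tD i j : (0 < i)%N -> (0 < j)%N -> odd (i + j) -> (7 <= i + j)%N ->
    (-1) ^+ j *: t i.+1 j + t i j.+1 = 0 by exact: tdefect_interior.
pose r := m.*2.+2; have nE : n = r.*2.+4 by rewrite /n /r; lia.
clearbody n; rewrite {n}nE.
pose W k i j := iter k shift T (p @ i.*2) (b @ j.*2).
have W0 i j : (0 < i)%N -> (0 < j)%N -> (i + j = r.+1)%N -> W 0%N i.+1 j + W 0%N i j.+1 = 0.
  move=> i0 j0 ij; have := tD i.*2.+1 j.*2; have := tD i.*2 j.*2.+1.
  rewrite -[W _ _ _]/(t i.*2.+2 j.*2) -[W _ i _]/(t i.*2 j.*2.+2).
  rewrite addnS addSn -doubleD /= odd_double !exprS -signr_odd odd_double expr0 mulr1.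
  rewrite !scaleN1r !scale1r double_gt0 ij => /(_ i0 isT isT isT)/eqP.
  rewrite addrC subr_eq0 => /eqP -> /(_ isT _ isT isT) -> //.
  by rewrite double_gt0.
have := alternating_array (fun k i j => erefl) W0.
rewrite [LHS](cyclic_sqr (cyclic_iter_shift r.+2 cyclic_associator) hb) => /esym.
rewrite -[W _ _ 0%N]/(t r.*2.+4 0%N) -[W _ _ 1%N]/(t r.*2.+2 2).
rewrite -[W _ 1%N _]/(t 2 r.*2.+2) -[W _ 0%N _]/(t 0%N r.*2.+4).
have := tD r.*2.+2 1%N isT isT; have := tD 1%N r.*2.+2 isT isT.
rewrite addn1 add1n /= !negbK odd_double expr1 -signr_odd /= negbK odd_double expr0.
rewrite scaleN1r scale1r => /(_ isT isT)/eqP; rewrite addr_eq0 => /eqP ->.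
move=> /(_ isT isT)/eqP; rewrite addrC subr_eq0 => /eqP -> e.
rewrite -[LHS]/(t r.*2.+4 0%N + t 0%N r.*2.+4 + t r.*2.+3 1%N - t 1%N r.*2.+3) -[RHS]e.
by rewrite [RHS](AC (2*2) (1*4*2*3)).
Qed.

End Derivation.
End Central.

(** * The trilinear form of the element u_n *)

Section Trilinear.
Variables (V : zmodType) (mul : V -> V -> V).
Hypothesis mulDl : forall v, {morph mul^~ v : u u' / u + u'}.
Hypothesis mulDr : forall u, {morph mul u : v v' / v + v'}.

(** The left-normed commutator [b, y_1, ..., y_k]. *)
Definition leftnormed (y : nat -> V) k b := foldl (commutator mul) b [seq y i | i <- iota 1 k].

(** The trilinear map whose restriction to the diagonal is u_n. *)
Definition u_trilinear n (y : nat -> V) u v w :=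
  associator mul (leftnormed y n.-1 (mul u v)) w (y n)
  - associator mul (leftnormed y n.-1 w) (mul u v) (y n).

Lemma leftnormedD y k : {morph leftnormed y k : u u' / u + u'}.
Proof.
rewrite /leftnormed; elim: [seq _ | _ <- _] => [//|v s IHs] u u'.
by rewrite /= (commutator_addl mulDl mulDr) IHs.
Qed.

Lemma leftnormedS y k b :
  leftnormed y k.+1 b = commutator mul (leftnormed y k b) (y k.+1).
Proof.
rewrite /leftnormed; have -> : iota 1 k.+1 = rcons (iota 1 k) k.+1.
  by rewrite -{1}[k.+1]addn1 iotaD cats1 add1n.
by rewrite map_rcons -cats1 foldl_cat.
Qed.

Lemma u_trilinear_addl n y v w : {morph (fun u => u_trilinear n y u v w) : u u' / u + u'}.
Proof.
move=> u u'; rewrite /u_trilinear mulDl leftnormedD (associator_addl mulDl).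
by rewrite (associator_addm mulDl mulDr) opprD addrACA.
Qed.

Lemma u_trilinear_addm n y u w : {morph (fun v => u_trilinear n y u v w) : v v' / v + v'}.
Proof.
move=> v v'; rewrite /u_trilinear mulDr leftnormedD (associator_addl mulDl).
by rewrite (associator_addm mulDl mulDr) opprD addrACA.
Qed.

Lemma u_trilinear_addr n y u v : {morph u_trilinear n y u v : w w' / w + w'}.
Proof.
move=> w w'; rewrite /u_trilinear leftnormedD (associator_addl mulDl) (associator_addm mulDl mulDr).
by rewrite opprD addrACA.
Qed.

Lemma u_ordinary_sum n y (r : seq nat) (f : nat -> V) :
  u_ordinary mul n (\sum_(i <- r) f i) y =
    \sum_(i <- r) \sum_(j <- r) \sum_(k <- r) u_trilinear n y (f i) (f j) (f k).
Proof.
rewrite -[LHS]/(u_trilinear n y _ _ _) (additive_sum (u_trilinear_addl n y _ _)).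
apply: eq_bigr => i _; rewrite (additive_sum (u_trilinear_addm n y _ _)).
by apply: eq_bigr => j _; rewrite (additive_sum (u_trilinear_addr n y _ _)).
Qed.

End Trilinear.

(** * Values of super-versions *)

Lemma inversions_cat (s t : seq nat) :
  inversions (s ++ t) =
    (inversions s + inversions t + \sum_(i <- s) count (fun j => j < i) t)%N.
Proof.
elim: s => [|i s IHs] /=; first by rewrite big_nil addn0.
by rewrite IHs count_cat big_cons; lia.
Qed.

Section Values.
Variables (F : fieldType) (A : superalgType F).
Local Notation malgW := {malg F[word nat]}.

Let nmul_inner_add (c : F) (s t : word nat) :
  {morph (fun d : F => << c * d *g Join s t >> : malgW) : d d' / d + d'}.
Proof. by move=> d d'; rewrite mulrDr monalgUD. Qed.

Let nmul_outer_add (g : malgW) (s : word nat) :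
  {morph (fun c : F => suppsum (fun t d => << c * d *g Join s t >> : malgW) g) : c c' / c + c'}.
Proof.
move=> c c'; rewrite /suppsum -big_split /=; apply: eq_bigr => t _.
by rewrite mulrDl monalgUD.
Qed.

Lemma nmulE (f g : malgW) : nmul f g =
  suppsum (fun s c => suppsum (fun t d => << c * d *g Join s t >>) g) f.
Proof. by []. Qed.

Lemma nmulDl (g : malgW) : {morph (@nmul F _)^~ g : f f' / f + f'}.
Proof. by move=> f f'; rewrite !nmulE suppsumD //; exact: (nmul_outer_add g). Qed.

Lemma nmulDr (f : malgW) : {morph nmul f : g g' / g + g'}.
Proof.
move=> g g'; rewrite !nmulE /suppsum -big_split /=; apply: eq_bigr => s _.
exact: (suppsumD (nmul_inner_add f@_s s) g g').
Qed.

Lemma nmulU (c d : F) (s t : word nat) :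
  nmul << c *g s >> << d *g t >> = << c * d *g Join s t >> :> malgW.
Proof.
rewrite nmulE suppsumU; last exact: (nmul_outer_add << d *g t >>).
by rewrite suppsumU // => t'; exact: (nmul_inner_add c s t').
Qed.

(** The linear combinations of the words that have the letters of L, with multiplicities:
    the multihomogeneous elements of the free algebra. *)
Inductive spanned (L : seq nat) : malgW -> Prop :=
| Spanned0 : spanned L 0
| SpannedU c w : perm_eq (letters w) L -> spanned L << c *g w >>
| SpannedD f g : spanned L f -> spanned L g -> spanned L (f + g).

Lemma spanned_opp L f : spanned L f -> spanned L (- f).
Proof.
elim=> [|c w pw|f' g _ IHf _ IHg].
- by rewrite oppr0; apply: Spanned0.
- by rewrite -monalgUN; apply: SpannedU.
- by rewrite opprD; apply: SpannedD IHf IHg.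
Qed.

Lemma spanned_perm L L' f : perm_eq L L' -> spanned L f -> spanned L' f.
Proof.
move=> LL'; elim=> [|c w pw|f' g _ IHf _ IHg].
- exact: Spanned0.
- by apply: SpannedU; apply: perm_trans LL'.
- exact: SpannedD IHf IHg.
Qed.

Lemma spanned_nmul L L' f g : spanned L f -> spanned L' g -> spanned (L ++ L') (nmul f g).
Proof.
move=> sf sg; elim: sf => [|c w pw|f1 f2 _ IH1 _ IH2].
- by rewrite (additive0 (nmulDl g)); apply: Spanned0.
- elim: sg => [|d t pt|g1 g2 _ IH1 _ IH2].
  + by rewrite (additive0 (nmulDr _)); apply: Spanned0.
  + by rewrite (nmulU c d w t); apply: SpannedU; apply: perm_cat.
  + by rewrite (nmulDr _ g1 g2); apply: SpannedD IH1 IH2.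
- by rewrite (nmulDl g f1 f2); apply: SpannedD IH1 IH2.
Qed.

Lemma spanned_additive (B B' : malgW -> A) L f :
  {morph B : u v / u + v} -> {morph B' : u v / u + v} ->
  (forall c w, perm_eq (letters w) L -> B << c *g w >> = B' << c *g w >>) ->
  spanned L f -> B f = B' f.
Proof.
move=> BD BD' BU; elim=> [|//|f1 f2 _ IH1 _ IH2]; last by rewrite BD BD' IH1 IH2.
by rewrite (additive0 BD) (additive0 BD').
Qed.

Lemma spanned_biadditive (B B' : malgW -> malgW -> A) L L' f g :
  (forall v, {morph B^~ v : u u' / u + u'}) -> (forall u, {morph B u : v v' / v + v'}) ->
  (forall v, {morph B'^~ v : u u' / u + u'}) -> (forall u, {morph B' u : v v' / v + v'}) ->
  (forall c d s t, perm_eq (letters s) L -> perm_eq (letters t) L' ->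
    B << c *g s >> << d *g t >> = B' << c *g s >> << d *g t >>) ->
  spanned L f -> spanned L' g -> B f g = B' f g.
Proof.
move=> Bl Br Bl' Br' BU sf sg; apply: (spanned_additive (Bl g) (Bl' g)) sf => c s ps.
by apply: (spanned_additive (Br _) (Br' _)) sg => d t; apply: BU.
Qed.

Variables (e : nat -> bool) (h : nat -> A).
Hypothesis he : forall i, homogeneous (e i) (h i).

Local Notation Sv := (fun f => super_version f e h).
Local Notation sgn w := ((-1 : F) ^+ inversions [seq i <- letters w | e i]).

Let term (w : word nat) (c : F) : A := (c * sgn w) *: word_eval h w.

Let termD w : {morph term w : c d / c + d}.
Proof. by move=> c d; rewrite /term mulrDl scalerDl. Qed.

Lemma super_versionD : {morph Sv : f g / f + g}.
Proof. exact: (suppsumD termD). Qed.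

Lemma super_versionU c w : Sv << c *g w >> = (c * sgn w) *: word_eval h w.
Proof. exact: (suppsumU termD). Qed.

(** The number of pairs of odd letters, one of L and one of L', out of order in L ++ L'. It
    depends on L and L' only up to permutation, so that super-versions are multiplicative
    up to a sign on multihomogeneous elements. *)
Definition crossing (L L' : seq nat) : nat :=
  \sum_(i <- L | e i) count (fun j => e j && (j < i))%N L'.

Lemma crossing_perm L1 L1' L2 L2' : perm_eq L1 L1' -> perm_eq L2 L2' ->
  crossing L1 L2 = crossing L1' L2'.
Proof.
move=> p1 p2; rewrite /crossing (perm_big _ p1); apply: eq_bigr => i _.
exact: (permP p2).
Qed.

Lemma crossing_catl L1 L2 L : crossing (L1 ++ L2) L = (crossing L1 L + crossing L2 L)%N.
Proof. exact: big_cat. Qed.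

Lemma crossing_catr L L1 L2 : crossing L (L1 ++ L2) = (crossing L L1 + crossing L L2)%N.
Proof. by rewrite /crossing -big_split; apply: eq_bigr => i _; rewrite count_cat. Qed.

Lemma crossing_lt L L' : allrel (fun i j => i < j)%N L L' -> crossing L L' = 0%N.
Proof.
move=> /allrelP LL'; rewrite /crossing big1_seq // => i /andP[_ iL]; apply/eqP.
rewrite -leqn0 leqNgt -has_count.
by apply/hasPn => j jL'; rewrite negb_and -leqNgt (ltnW (LL' _ _ iL jL')) orbT.
Qed.

Lemma crossing_gt L L' : allrel (fun i j => i < j)%N L L' ->
  crossing L' L = (count e L' * count e L)%N.
Proof.
move=> /allrelP LL'; rewrite /crossing -sum1_count big_distrl /= big_seq_cond.
rewrite [RHS]big_seq_cond; apply: eq_bigr => j /andP[jL' _]; rewrite mul1n.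
by apply: eq_in_count => i /LL' -> //; rewrite andbT.
Qed.

Lemma sgn_Join s t :
  sgn (Join s t) = (-1) ^+ crossing (letters s) (letters t) * (sgn s * sgn t).
Proof.
rewrite /= filter_cat inversions_cat big_filter -!exprD addnC; congr (_ ^+ (_ + _)).
by apply: eq_bigr => i _; rewrite count_filter; apply: eq_count => j; rewrite /= andbC.
Qed.

Let super_version0 : Sv 0 = 0.
Proof. exact: (additive0 super_versionD). Qed.

Lemma super_version_nmul L L' f g : spanned L f -> spanned L' g ->
  Sv (nmul f g) = (-1) ^+ crossing L L' *: smul (Sv f) (Sv g).
Proof.
pose B u v := Sv (nmul u v); pose B' u v := (-1) ^+ crossing L L' *: smul (Sv u) (Sv v).
apply: (@spanned_biadditive B B') => [v u u'|u v v'|v u u'|u v v'|c d s t ps pt].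
- by rewrite /B nmulDl; apply: super_versionD.
- by rewrite /B nmulDr; apply: super_versionD.
- by rewrite /B' (super_versionD u u') smulDl scalerDr.
- by rewrite /B' (super_versionD v v') smulDr scalerDr.
rewrite /B /B' (nmulU c d s t) !super_versionU (sgn_Join s t) -(crossing_perm ps pt).
by rewrite smulZl smulZr !scalerA mulrCA mulrACA.
Qed.

Lemma word_eval_homogeneous w : homogeneous (odd (count e (letters w))) (word_eval h w).
Proof.
elim: w => [i|s IHs t IHt] /=; first by rewrite addn0 oddb.
by rewrite count_cat oddD; apply: homogeneousM.
Qed.

Lemma super_version_homogeneous L f : spanned L f -> homogeneous (odd (count e L)) (Sv f).
Proof.
elim=> [|c w pw|f' g _ IHf _ IHg].
- by rewrite super_version0; apply: homogeneous0.
- by rewrite super_versionU; apply: homogeneousZ; rewrite -(permP pw); apply: word_eval_homogeneous.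
- by rewrite (super_versionD f' g); apply: homogeneousD IHf IHg.
Qed.

Lemma super_version_zvar i : Sv (zvar F i) = h i.
Proof. by rewrite /zvar super_versionU /=; case: (e i); rewrite /= expr0 mulr1 scale1r. Qed.

Lemma spanned_zvar i : spanned [:: i] (zvar F i).
Proof. exact: SpannedU. Qed.

Local Notation comm := (commutator (@nmul F nat)).
Local Notation gassoc := (associator (@nmul F nat)).

Lemma spanned_commutator L L' f g : spanned L f -> spanned L' g ->
  spanned (L ++ L') (comm f g).
Proof.
move=> sf sg; have sgf := spanned_perm (permEl (perm_catC L' L)) (spanned_nmul sg sf).
exact: SpannedD (spanned_nmul sf sg) (spanned_opp sgf).
Qed.

(** An ordinary commutator becomes a supercommutator when the letters of the right-hand
    factor are larger than those of the left-hand one. *)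
Lemma super_version_commutator L L' f g : spanned L f -> spanned L' g ->
  allrel (fun i j => i < j)%N L L' -> Sv (comm f g) = scommutator (Sv f) (Sv g).
Proof.
move=> sf sg LL'.
have E := congr2 (fun u v => u - v) (super_version_nmul sf sg) (super_version_nmul sg sf).
apply: etrans (additiveB super_versionD _ _) _; apply: etrans E _.
rewrite (scommutatorE (super_version_homogeneous sf) (super_version_homogeneous sg)).
rewrite (crossing_lt LL') (crossing_gt LL').
by rewrite expr0 scale1r /ksign -[in LHS]signr_odd oddM andbC.
Qed.

Lemma spanned_associator L1 L2 L3 f g k : spanned L1 f -> spanned L2 g -> spanned L3 k ->
  spanned (L1 ++ L2 ++ L3) (gassoc f g k).
Proof.
move=> sf sg sk; have sl := spanned_nmul (spanned_nmul sf sg) sk; rewrite -catA in sl.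
exact: SpannedD sl (spanned_opp (spanned_nmul sf (spanned_nmul sg sk))).
Qed.

Lemma super_version_associator L1 L2 L3 f g k u v w :
  spanned L1 f -> spanned L2 g -> spanned L3 k -> Sv f = u -> Sv g = v -> Sv k = w ->
  Sv (gassoc f g k) =
    (-1) ^+ (crossing L1 L2 + crossing L1 L3 + crossing L2 L3)
      *: associator (@smul F A) u v w.
Proof.
move=> sf sg sk <- <- <-; apply: etrans (additiveB super_versionD _ _) _.
have El : Sv (nmul (nmul f g) k) = (-1) ^+ crossing (L1 ++ L2) L3
    *: smul ((-1) ^+ crossing L1 L2 *: smul (Sv f) (Sv g)) (Sv k).
  by rewrite -(super_version_nmul sf sg); apply: super_version_nmul sk; apply: spanned_nmul.
have Er : Sv (nmul f (nmul g k)) = (-1) ^+ crossing L1 (L2 ++ L3)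
    *: smul (Sv f) ((-1) ^+ crossing L2 L3 *: smul (Sv g) (Sv k)).
  by rewrite -(super_version_nmul sg sk); apply: super_version_nmul sf _; apply: spanned_nmul.
apply: etrans (congr2 (fun u v => u - v) El Er) _.
rewrite crossing_catl crossing_catr smulZl smulZr !scalerA -!exprD.
rewrite [in RHS]/associator scalerBr; congr (_ ^+ _ *: _ - _ ^+ _ *: _); lia.
Qed.

(** ** The multilinear component *)

Let mterm r (w : word nat) (c : F) : A :=
  if perm_eq (letters w) (iota 1 r) then term w c else 0.

Let mtermD r w : {morph mterm r w : c d / c + d}.
Proof. by move=> c d; rewrite /mterm; case: ifP; rewrite ?addr0 // => _; apply: termD. Qed.

Lemma super_version_multilinear r f : Sv (multilinear_part r f) = suppsum (mterm r) f.
Proof.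
rewrite /multilinear_part (additive_sum super_versionD) big_mkcond.
apply: eq_bigr => w _; rewrite /mterm.
by case: ifP => // _; rewrite super_versionU.
Qed.

Lemma multilinear_partD r :
  {morph (fun f => Sv (multilinear_part r f)) : f g / f + g}.
Proof.
move=> f g; apply: etrans (super_version_multilinear r (f + g)) _.
apply: etrans (suppsumD (mtermD r) f g) _.
by apply: congr2; apply: esym; apply: super_version_multilinear.
Qed.

Lemma multilinear_spanned r L f : spanned L f ->
  Sv (multilinear_part r f) = if perm_eq L (iota 1 r) then Sv f else 0.
Proof.
pose B' g := if perm_eq L (iota 1 r) then Sv g else 0.
apply: (@spanned_additive (fun g => Sv (multilinear_part r g)) B').
- exact: multilinear_partD.
- by move=> u v; rewrite /B'; case: ifP => _; rewrite ?addr0 // super_versionD.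
- move=> c w pw; rewrite super_version_multilinear (suppsumU (mtermD r)) /B' super_versionU.
  by rewrite /mterm (permPl pw).
Qed.

(** ** Values with the odd argument x in the skew-symmetric places *)

Section Tail.
Variables (x : A).
Hypothesis ex : forall i, (4 <= i)%N -> e i /\ h i = x.

Let y i := zvar F (i + 3).

Let iota_last k : iota 4 k.+1 = iota 4 k ++ [:: (k.+1 + 3)%N].
Proof. by rewrite -[k.+1 in LHS]addn1 iotaD; congr (_ ++ [:: _]); lia. Qed.

(** Left-normed commutators of elements in z_1, z_2, z_3 with z_4, z_5, ... become iterated
    supercommutators with x. *)
Lemma super_version_leftnormed L f k : spanned L f -> all (fun i => i < 4)%N L ->
  let g := leftnormed (@nmul F nat) y k f in
  spanned (L ++ iota 4 k) g /\ Sv g = scomm_iter x (Sv f) k.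
Proof.
move=> sf L4; elim: k => [|k [IHs IHk]]; first by rewrite cats0.
rewrite leftnormedS; have zk := spanned_zvar (k.+1 + 3).
split; first by rewrite iota_last catA; apply: spanned_commutator.
rewrite (super_version_commutator IHs zk); last first.
  apply/allrelP => i j; rewrite mem_cat inE mem_iota => /orP[/(allP L4)|] + /eqP ->; lia.
by rewrite IHk super_version_zvar; have [|_ ->] := ex (i := k.+1 + 3); first by lia.
Qed.

Lemma super_version_u_trilinear n i j k : (i < 4)%N -> (j < 4)%N -> (k < 4)%N ->
  let f := u_trilinear (@nmul F nat) n.+1 y (zvar F i) (zvar F j) (zvar F k) in
  let hij := (-1) ^+ crossing [:: i] [:: j] *: smul (h i) (h j) in
  spanned ([:: i; j; k] ++ iota 4 n.+1) f /\
  Sv f =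
    (-1) ^+ crossing ([:: i; j] ++ iota 4 n) [:: k]
      *: associator (@smul F A) (scomm_iter x hij n) (h k) x
    - (-1) ^+ crossing (k :: iota 4 n) [:: i; j]
      *: associator (@smul F A) (scomm_iter x (h k) n) hij x.
Proof.
move=> i4 j4 k4 f hij.
have si := spanned_zvar i; have sj := spanned_zvar j; have sk := spanned_zvar k.
have sij := spanned_nmul si sj; have sy := spanned_zvar (n.+1 + 3).
have ij4 : all (fun l => l < 4)%N ([:: i] ++ [:: j]) by rewrite /= i4 j4.
have kk4 : all (fun l => l < 4)%N [:: k] by rewrite /= k4.
have [sl Sl] := super_version_leftnormed n sij ij4.
have [sr Sr] := super_version_leftnormed n sk kk4.
have Sij : Sv (nmul (zvar F i) (zvar F j)) = hij.
  by apply: etrans (super_version_nmul si sj) _; congr (_ *: smul _ _); apply: super_version_zvar.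
have Sy : Sv (zvar F (n.+1 + 3)) = x.
  by rewrite super_version_zvar; have [|_ ->] := ex (i := n.+1 + 3); first by lia.
have sA := spanned_associator sl sk sy; have sB := spanned_associator sr sij sy.
split.
  apply: SpannedD (spanned_perm _ sA) (spanned_opp (spanned_perm _ sB));
    apply/permP => q; rewrite iota_last !count_cat /=; lia.
have last_lt L : all (fun l => l < n.+1 + 3)%N L -> crossing L [:: (n.+1 + 3)%N] = 0%N.
  by move=> Ln; apply/crossing_lt/allrelP => l l' /(allP Ln) lt; rewrite inE => /eqP ->.
have iota_lt : all (fun l => l < n.+1 + 3)%N (iota 4 n).
  by apply/allP => l; rewrite mem_iota; lia.
have small_lt l : (l < 4)%N -> (l < n.+1 + 3)%N by lia.
rewrite super_version_zvar in Sr; rewrite Sij in Sl.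
have EA := super_version_associator sl sk sy Sl (super_version_zvar k) Sy.
have EB := super_version_associator sr sij sy Sr Sij Sy.
apply: etrans (additiveB super_versionD _ _) _; apply: etrans (congr2 (fun u v => u - v) EA EB) _.
by rewrite !last_lt ?addn0 //= ?small_lt ?iota_lt.
Qed.

End Tail.

End Values.

(** * The value that gives u_(4m+1) *)

Lemma sum_permutations3 (V : nmodType) (G : nat -> nat -> nat -> V) :
  \sum_(i <- [:: 1; 2; 3]%N) \sum_(j <- [:: 1; 2; 3]%N) \sum_(k <- [:: 1; 2; 3]%N)
    (if perm_eq [:: i; j; k] [:: 1; 2; 3]%N then G i j k else 0) =
  G 1%N 2%N 3%N + G 1%N 3%N 2%N + (G 2%N 1%N 3%N + G 2%N 3%N 1%N)
    + (G 3%N 1%N 2%N + G 3%N 2%N 1%N).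
Proof.
rewrite !big_cons !big_nil /= !addr0 !add0r.
by rewrite [LHS]addrA.
Qed.

Section Linearized.
Variables (F : fieldType) (A : superalgType F).
Variables (e : nat -> bool) (h : nat -> A).
Hypothesis he : forall i, homogeneous (e i) (h i).
Variable x : A.
Hypothesis ex : forall i, (4 <= i)%N -> e i /\ h i = x.
Local Notation T u v := (associator (@smul F A) u v x).

(** The super-version of the value at (z_i, z_j, z_k) of the trilinear form of u_(n+1), when x
    is substituted for all the letters from z_4 on. *)
Definition u_component n i j k : A :=
  let hij := (-1) ^+ crossing e [:: i] [:: j] *: smul (h i) (h j) in
  (-1) ^+ crossing e ([:: i; j] ++ iota 4 n) [:: k] *: T (scomm_iter x hij n) (h k)
  - (-1) ^+ crossing e (k :: iota 4 n) [:: i; j] *: T (scomm_iter x (h k) n) hij.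

(** Of the 27 values of the trilinear form at z_1, z_2, z_3, the multilinear component keeps
    those with distinct arguments. *)
Lemma super_version_u_linearized n :
  super_version (u_linearized F n.+1) e h =
    u_component n 1 2 3 + u_component n 1 3 2
    + (u_component n 2 1 3 + u_component n 2 3 1)
    + (u_component n 3 1 2 + u_component n 3 2 1).
Proof.
rewrite -(sum_permutations3 (u_component n)).
have sum3 (V : nmodType) (f : nat -> V) : f 1%N + f 2 + f 3 = \sum_(i <- [:: 1; 2; 3]%N) f i.
  by rewrite !big_cons big_nil addr0 addrA.
pose M f := super_version (multilinear_part (n.+1 + 3) f) e h.
have MD : {morph M : f g / f + g} := multilinear_partD e h _.
pose y i := zvar F (i + 3); pose z := \sum_(i <- [:: 1; 2; 3]%N) zvar F i.
have -> : u_linearized F n.+1 =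
    multilinear_part (n.+1 + 3) (u_ordinary (@nmul F nat) n.+1 z y).
  exact: (congr1 (fun t => multilinear_part (n.+1 + 3) (u_ordinary (@nmul F nat) n.+1 t y))
            (sum3 _ (zvar F))).
apply: etrans (congr1 M (u_ordinary_sum (@nmulDl F) (@nmulDr F) n.+1 y _ _)) _.
have lt4 i : i \in [:: 1; 2; 3]%N -> (i < 4)%N by rewrite !inE => /or3P[] /eqP ->.
rewrite (additive_sum MD) big_seq [RHS]big_seq; apply: eq_bigr => i /lt4 i4.
rewrite (additive_sum MD) big_seq [RHS]big_seq; apply: eq_bigr => j /lt4 j4.
rewrite (additive_sum MD) big_seq [RHS]big_seq; apply: eq_bigr => k /lt4 k4.
have [sf Sf] := super_version_u_trilinear he ex n i4 j4 k4.
apply: etrans (multilinear_spanned e h _ sf) _.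
have -> : iota 1 (n.+1 + 3) = [:: 1; 2; 3]%N ++ iota 4 n.+1 by rewrite addnC iotaD.
by rewrite perm_cat2r; case: ifP.
Qed.

End Linearized.

Section Main.
Variables (F : fieldType) (charF0 : [pchar F] =i pred0).
Variables (A : superalgType F) (altA : alternative_superalgebra A).
Variables (a x : A).
Hypotheses (ha : homogeneous false a) (hx : homogeneous true x).
Local Notation T u v := (associator (@smul F A) u v x).
Local Notation "p @ i" := (scomm_iter x p i) (at level 20).
Let p := smul a a.

Let hp : homogeneous false p. Proof. exact: (homogeneousM ha ha). Qed.

Lemma associator_even_swap u v : homogeneous false u -> homogeneous false v ->
  T u v = - T v u.
Proof. by move=> hu hv; rewrite (associatorC_l altA hv hu hx) /ksign expr0 scale1r. Qed.

Lemma associator_odd_swap u v : homogeneous true u -> homogeneous true v -> T u v = T v u.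
Proof.
by move=> hu hv; rewrite (associatorC_l altA hv hu hx) /ksign expr1 scaleN1r opprK.
Qed.

(** The arguments z_1 = z_2 = a, z_3 = [a, x] and z_i = x for i > 3; the letter z_0 does not
    occur. *)
Definition special_args (i : nat) : A := nth x [:: a; a; a; scommutator a x] i.

Lemma special_args_homogeneous i : homogeneous (2 < i)%N (special_args i).
Proof.
case: i => [|[|[|[|i]]]] //; last by rewrite /special_args nth_default.
exact: (homogeneous_scommutator ha hx).
Qed.

Lemma super_version_special n : odd n ->
  super_version (u_linearized F n.+1) (fun i => 2 < i)%N special_args =
    2%:R *: (T (p @ n.+1) a - T (a @ n.+1) p - T (p @ n) (a @ 1) + T (a @ n) (p @ 1)).
Proof.
move=> on; set e := fun i : nat => _.
have he : forall i, homogeneous (e i) (special_args i) := special_args_homogeneous.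
have ex i : (4 <= i)%N -> e i /\ special_args i = x.
  by move=> i4; split; [rewrite /e; lia | rewrite /special_args nth_default].
rewrite (super_version_u_linearized he ex n).
(* The only sign is that of z_3 passing over the n letters x, where n is odd. *)
have ct : count e (iota 4 n) = n.
  rewrite -[RHS](size_iota 4); apply/eqP; rewrite -all_count; apply/allP => i.
  by rewrite mem_iota => /andP[/ex[]].
have cross L L' : all (fun i => i < 4)%N L' ->
    crossing e (L ++ iota 4 n) L' = (crossing e L L' + n * count e L')%N.
  move=> L4; rewrite crossing_catl -{2}ct; congr (_ + _)%N; apply: crossing_gt.
  by apply/allrelP => i j /(allP L4) i4; rewrite mem_iota => /andP[j4 _]; apply: leq_trans j4.
rewrite /u_component -[1%N :: iota _ _]/([:: 1%N] ++ _) -[2%N :: iota _ _]/([:: 2%N] ++ _).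
rewrite -[3%N :: iota _ _]/([:: 3%N] ++ _) !cross //.
have c0 L L' : all (fun i => i < 4)%N L -> crossing e L L' = 0%N.
  move=> /allP L4; rewrite /crossing big1_seq // => i /andP[_ /L4 i4].
  rewrite (eq_count (a2 := pred0)) ?count_pred0 // => j; rewrite /e /=; lia.
rewrite !c0 // !expr0 !scale1r !add0n.
rewrite -[special_args 1]/a -[special_args 2]/a -[special_args 3]/(a @ 1).
rewrite -[count e [:: 3%N]]/1%N -[count e [:: 1; 2]%N]/0%N.
rewrite !muln0 !muln1 !expr0 !scale1r -/p -signr_odd on expr1 !scaleN1r !opprK.
(* D(aa) = a [a, x] + [a, x] a joins the terms with a [a, x] and with [a, x] a *)
have pn : p @ n.+1 = (smul a (a @ 1)) @ n + (smul (a @ 1) a) @ n.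
  by rewrite -addn1 scomm_iterD [p @ 1](derive_sqr charF0 altA hx ha) scomm_iter_add.
have an : a @ n.+1 = (a @ 1) @ n by rewrite -addn1 scomm_iterD.
rewrite pn an [p @ 1](derive_sqr charF0 altA hx ha) associatorDl associatorDm.
rewrite scaler_nat mulr2n addrACA.
by congr (_ + _); rewrite [LHS](AC ((2*2)*2) ((3*5)*2*1*(4*6))).
Qed.

(** The value above is 4 u_(4m+1): its first two terms are u_(4m+1) by definition, and the
    other two are u_(4m+1) by the boundary relation. *)
Lemma u_super_verbal m : (0 < m)%N -> verbal_subsuperalgebra A (4 * m) (u_super (4 * m + 1) a x).
Proof.
move=> m0; have [n nE on] : exists2 n, (4 * m = n.+1)%N & odd n.
  by exists (4 * m).-1; [rewrite prednK ?muln_gt0 | lia].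
have rel : T (p @ n.+1) a + T p (a @ n.+1) + T (p @ n) (a @ 1) - T (p @ 1) (a @ n) = 0.
  by have := boundary_relation charF0 altA hx ha m0; rewrite nE.
rewrite {}nE.
have uE : u_super (n.+1 + 1) a x = T (p @ n.+1) a - T (a @ n.+1) p by rewrite /u_super addn1.
pose u := u_super (n.+1 + 1) a x.
have hn i v : homogeneous false v -> odd i -> homogeneous true (v @ i).
  by move=> hv oi; have := homogeneous_iter hx i hv; rewrite oi.
have h_even : homogeneous false (a @ n.+1).
  by have := homogeneous_iter hx n.+1 ha; rewrite /= on.
have E : super_version (u_linearized F n.+1) (fun i => 2 < i)%N special_args = 4%:R *: u.
  rewrite (super_version_special on) -[4%N]/(2 * 2)%N natrM -scalerA; congr (_ *: _).
  rewrite scaler_nat mulr2n [u]uE -[LHS]addrA; congr (_ + _).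
  rewrite (associator_odd_swap (hn _ _ ha on) (hn 1%N _ hp isT)).
  move: rel; rewrite (associator_even_swap hp h_even) => /eqP.
  by rewrite subr_eq0 => /eqP <-; rewrite addrC addrK.
move=> S sub val; have [S0 SD _ _] := sub.
have n4 : 4%:R != 0 :> F by rewrite (iffLR (pcharf0P F) charF0).
have -> : u_super (n.+1 + 1) a x = 4%:R^-1 *: (4%:R *: u) + 0.
  by rewrite addr0 scalerA mulVf ?scale1r.
apply: SD S0; apply: val; exists (fun i => 2 < i)%N, special_args; split; last by rewrite E.
exact: special_args_homogeneous.
Qed.

End Main.

Theorem proposition4p1 (F : fieldType) (charF0 : [pchar F] =i pred0)
    (A : superalgType F) (a x : A) (freeA : free_alternative_superalgebra a x)
    (m : nat) (m_ge1 : (1 <= m)%N) :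
  verbal_subsuperalgebra A (4 * m) (u_super (4 * m + 1) a x).
Proof.
by have [altA ha hx _] := freeA; apply: u_super_verbal.
Qed.
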